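(* Let $G_m=([n],E_m)$ be the random graph process and $\tau_1=\min\{m:\delta(G_m)\ge1\}$. Color each edge of $G_{\tau_1}$ black or white independently and uniformly at random. Then with high probability, for every pair of distinct vertices $x,y\in[n]$ there is a zebraic path in $G_{\tau_1}$ joining $x$ and $y$.
   Context: The random graph process: $E_0=\emptyset$ and $E_m=E_{m-1}\cup\{e_m\}$ where $e_m$ is chosen uniformly at random among the edges of $K_n$ not in $E_{m-1}$. A path in a black/white edge-colored graph is zebraic if the colors of its edges alternate along it. ''With high probability'' means with probability $1-o(1)$ as $n\to\infty$. *)

(* Defs.v *)
From HB Require Import structures.
From mathcomp Require Import all_boot all_order all_algebra all_fingroup.
From Stdlib Require Import ClassicalEpsilon.
Set Implicit Arguments. Unset Strict Implicit. Unset Printing Implicit Defensive.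

Definition asbool (P : Prop) : bool :=
  if excluded_middle_informative P then true else false.

Definition edge (n : nat) := {e : {set 'I_n} | #|e| == 2}.

Definition Nedges (n : nat) : nat := #|{: edge n}|.

(* A uniformly random ordering (e_1, ..., e_N) of the edges of K_n is encoded by a
   permutation s of the edges: the edge e is added at step (position s e) + 1.
   This is exactly the random graph process. *)
Definition position n (s : {perm edge n}) (e : edge n) : nat := enum_rank (s e).

Definition Eproc n (s : {perm edge n}) (m : nat) : {set edge n} :=
  [set e | position s e < m].

Definition mindeg_ge1 n (E : {set edge n}) : bool :=
  [forall v : 'I_n, [exists e in E, v \in val e]].

Definition tau1 n (s : {perm edge n}) : nat :=
  find (fun m => mindeg_ge1 (Eproc s m)) (iota 0 (Nedges n).+1).

Definition adj n (E : {set edge n}) (u v : 'I_n) : bool :=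
  [exists e in E, val e == [set u; v]].

Definition ecol n (c : {ffun edge n -> bool}) (u v : 'I_n) : bool :=
  [exists e : edge n, (val e == [set u; v]) && c e].

Definition zebraic_path n (E : {set edge n}) (c : {ffun edge n -> bool})
    (x y : 'I_n) : Prop :=
  exists p : seq 'I_n,
    [/\ uniq (x :: p), last x p = y, path (adj E) x p &
        sorted (fun a b : bool => a != b) (pairmap (ecol c) x p)].

Definition all_pairs_zebraic n (s : {perm edge n}) (c : {ffun edge n -> bool}) : Prop :=
  forall x y : 'I_n, x <> y -> zebraic_path (Eproc s (tau1 s)) c x y.

(* Probability space: uniform ordering of edges x uniform colouring.  Colouring all
   edges of K_n independently and uniformly induces the independent uniform colouring
   of the edges of G_{tau_1}; the event only depends on colours of edges of G_{tau_1}. *)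
Definition prob_fail (n : nat) : rat :=
  (#|[set w : {perm edge n} * {ffun edge n -> bool} |
       ~~ asbool (all_pairs_zebraic w.1 w.2)]|)%:R
  / (#|{: {perm edge n} * {ffun edge n -> bool}}|)%:R.

(* Main.v *)
(** Let l = ln n, let D be the process after m0 ~ (19/40) n l steps and let
    m1 ~ n l; a first and a second moment computation on isolated vertices give
    m0 <= tau_1 <= m1 with high probability.  Put t ~ l / 1000 and call a vertex
    rich if it has more than K = 16 t + 2 edges of each colour in D.  By union
    bounds, with high probability:
    - no vertex has three neighbours in D that are not rich, and a vertex with
      few edges of both colours has, in G_(m1), only rich neighbours and no
      non-rich vertex at distance two;
    - every set U of at most n / lam vertices spans fewer than t |U| edges of D;
    - any two disjoint sets of at least n / (20 lam) vertices are joined in D by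
      an edge of each colour.
    Then distinct non-adjacent x and y have distinct rich neighbours w and z in
    G_(tau_1).  From w and z, alternating in colour with the edges xw and yz,
    two disjoint trees of rich vertices are grown simultaneously, with layers of
    exactly 2^i vertices: if the next layer of one tree could not be twice as
    large as the current one, the vertices visited so far would span too many
    edges.  Keeping the two trees of equal size prevents one from absorbing the
    neighbours of the other.  Once the layers have linear size, an edge of the
    right colour joins them; if the two current colours differ, one tree is first
    grown by one more layer. *)

From HB Require Import structures.
From mathcomp Require Import all_boot all_order all_algebra all_fingroup.
From mathcomp Require Import ring lra zify.
From mathcomp Require Import Rstruct all_reals sequences exp.
Require Import Defs.
Set Implicit Arguments. Unset Strict Implicit. Unset Printing Implicit Defensive.
Import Order.TTheory GRing.Theory Num.Theory.
Local Open Scope ring_scope.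

(** * Expectation and probability on a finite uniform space *)

Section Expectation.
Variable R : realType.
Implicit Types (T : finType).

Definition Ex T (f : T -> R) : R := (\sum_t f t) / #|T|%:R.

Lemma Ex_le T (f g : T -> R) : (forall t, f t <= g t) -> Ex f <= Ex g.
Proof. by move=> fg; rewrite ler_wpM2r ?invr_ge0 ?ler0n// ler_sum. Qed.

Lemma Ex_ge0 T (f : T -> R) : (forall t, 0 <= f t) -> 0 <= Ex f.
Proof. by move=> f0; rewrite mulr_ge0 ?invr_ge0 ?ler0n// sumr_ge0. Qed.

Lemma eq_Ex T (f g : T -> R) : f =1 g -> Ex f = Ex g.
Proof. by move=> fg; rewrite /Ex (eq_bigr _ (fun t _ => fg t)). Qed.

Lemma ExD T (f g : T -> R) : Ex (fun t => f t + g t) = Ex f + Ex g.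
Proof. by rewrite /Ex big_split mulrDl. Qed.

Lemma ExZ T (k : R) (f : T -> R) : Ex (fun t => k * f t) = k * Ex f.
Proof. by rewrite /Ex -mulr_sumr mulrA. Qed.

Lemma Ex_sum T (I : finType) (f : I -> T -> R) :
  Ex (fun t => \sum_i f i t) = \sum_i Ex (f i).
Proof. by rewrite /Ex exchange_big mulr_suml. Qed.

Lemma Ex_cst T (k : R) : (0 < #|T|)%N -> Ex (fun _ : T => k) = k.
Proof.
move=> T0; rewrite /Ex sumr_const -[k *+ _]mulr_natr; apply: mulfK.
by rewrite pnatr_eq0 -lt0n.
Qed.

Lemma Ex_pair T1 T2 (f : T1 * T2 -> R) :
  Ex f = Ex (fun t1 => Ex (fun t2 => f (t1, t2))).
Proof.
rewrite /Ex card_prod natrM invfM mulrA -mulr_suml mulrAC; congr (_ / _ / _).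
by rewrite pair_big; apply: eq_bigr => -[].
Qed.

Definition Pr T (A : pred T) : R := Ex (fun t => (A t)%:R).

Lemma Pr_card T (A : pred T) : Pr A = #|[set t | A t]|%:R / #|T|%:R.
Proof.
rewrite /Pr /Ex -natr_sum -sum1_card [in RHS]big_mkcond; congr (_%:R / _).
by apply: eq_bigr => t _; rewrite inE; case: (A t).
Qed.

Lemma Pr_sub T (A B : pred T) : (forall t, A t -> B t) -> Pr A <= Pr B.
Proof.
by move=> AB; apply: Ex_le => t; rewrite ler_nat; case: (A t) (AB t) => // ->.
Qed.

Lemma Pr_or T (A B : pred T) : Pr (fun t => A t || B t) <= Pr A + Pr B.
Proof.
rewrite /Pr -ExD; apply: Ex_le => t.
by rewrite -natrD ler_nat; case: (A t) (B t) => [] [].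
Qed.

Lemma Pr_exists T (I : finType) (A : I -> pred T) (b : R) :
  (forall i, Pr (A i) <= b) -> Pr (fun t => [exists i, A i t]) <= #|I|%:R * b.
Proof.
move=> Ab; apply: (@le_trans _ _ (Ex (fun t => \sum_i (A i t)%:R))).
  apply: Ex_le => t; rewrite -natr_sum ler_nat.
  case: existsP => // -[i Ai]; rewrite (bigD1 i)//= Ai.
  exact: leq_addr.
rewrite Ex_sum; apply: (@le_trans _ _ (\sum_(i : I) b)).
  by apply: ler_sum => i _; exact: Ab.
by rewrite sumr_const mulr_natl.
Qed.

(** Markov's inequality, in the form used for exponential moments. *)
Lemma Pr_Ex T (A : pred T) (f : T -> R) :
  (forall t, 0 <= f t) -> (forall t, A t -> 1 <= f t) -> Pr A <= Ex f.
Proof. by move=> f0 Af; apply: Ex_le => t; case: (boolP (A t)) => // /Af. Qed.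

(** Independence of the colours: a sum over all colourings of a product over edges is a product of
    sums over the two colours. *)
Lemma Ex_ffun T (g : T -> bool -> R) :
  Ex (fun c : {ffun T -> bool} => \prod_e g e (c e)) =
  \prod_e ((g e true + g e false) / 2).
Proof.
rewrite /Ex -(bigA_distr_bigA g) card_ffun card_bool natrX.
rewrite -prodr_const -prodfV -big_split /=.
by apply: eq_bigr => e _; rewrite big_bool.
Qed.

End Expectation.

(** * Correlation bounds for a uniformly random permutation *)

Section RandomPermutation.
Variables (R : realType) (T : finType).
Implicit Types (s : {perm T}) (Q : pred T) (B M A : seq T).

(* Given the images of X, the image of e is uniform on what is left: swapping e
   with another point outside X preserves the law of s. *)
Lemma perm_step (X : {set T}) (f : {perm T} -> R) Q e : e \notin X ->
    (forall s u v, u \notin X -> v \notin X -> f (tperm u v * s)%g = f s) ->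
  #|~: X|%:R * Ex (fun s => f s * (Q (s e))%:R) =
  Ex (fun s => f s * #|[set u | u \notin X & Q (s u)]|%:R).
Proof.
move=> eX fX; rewrite /Ex mulrA; congr (_ / _).
transitivity (\sum_s \sum_(u in ~: X) f s * (Q (s u))%:R).
  rewrite exchange_big mulr_natl -sumr_const; apply: eq_bigr => u.
  rewrite inE => uX; rewrite (reindex_inj (mulgI (tperm e u))).
  by apply: eq_bigr => s _; rewrite fX// permM tpermL.
apply: eq_bigr => s _; rewrite -mulr_sumr -natr_sum; congr (_ * _%:R).
rewrite -sum1_card big_mkcond [RHS]big_mkcond; apply: eq_bigr => u _.
by rewrite !inE; case: (u \in X); case: (Q _).
Qed.

Lemma card_perm_pred Q s : #|[set u | Q (s u)]| = #|Q|.
Proof.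
transitivity #|[preim s of Q]|; first by apply: eq_card => u; rewrite !inE.
rewrite (card_preim (@perm_inj _ s)); apply: eq_card => u; rewrite !inE /=.
suff -> : u \in codom s by [].
by rewrite codomE; apply/mapP; exists (s^-1%g u); rewrite ?mem_enum// permKV.
Qed.

Lemma all_tperm Q M s u v : u \notin M -> v \notin M ->
  all (fun x => Q ((tperm u v * s)%g x)) M = all (fun x => Q (s x)) M.
Proof.
move=> uM vM; apply: eq_in_all => x xM; rewrite permM tpermD//.
  by apply: contraNneq uM => ->.
by apply: contraNneq vM => ->.
Qed.

Lemma card_unused Q M s : uniq M -> all (fun x => Q (s x)) M ->
  #|[set u | u \notin M & Q (s u)]| = (#|Q| - size M)%N.
Proof.
move=> uM /allP aM; rewrite -(card_perm_pred Q s) -(card_uniqP uM).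
rewrite -(cardsID [set u | u \in M] [set u | Q (s u)]).
rewrite (_ : _ :&: _ = [set u | u \in M]).
  by rewrite -[#|M|]cardsE addKn; apply: eq_card => u; rewrite !inE.
by apply/setP => u; rewrite !inE andbC; case: (boolP (u \in M)) => // /aM.
Qed.

(** Sampling without replacement: once [i] points of [M] have images in [Q], [#|Q| - i] of the
    [#|T| - i] free values lie in [Q]. *)
Lemma Pr_perm_all Q M : uniq M ->
  Pr R (fun s => all (fun x => Q (s x)) M) =
  \prod_(i < size M) ((#|Q| - i)%:R / (#|T| - i)%:R).
Proof.
elim: M => [_|e M IH /= /andP[eM uM]].
  rewrite big_ord0 /Pr (eq_Ex (g := fun=> 1))// Ex_cst//.
  by apply/card_gt0P; exists 1%g.
rewrite big_ord_recr /= -IH//.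
have X0 : #|~: [set u | u \in M]| = (#|T| - size M)%N.
  by rewrite cardsCs setCK cardsE (card_uniqP uM).
have := @perm_step [set u | u \in M] (fun s => (all (fun x => Q (s x)) M)%:R) Q e.
rewrite inE eM X0 => /(_ isT) H0.
have X1 : (0 < #|T| - size M)%N.
  by rewrite -X0; apply/card_gt0P; exists e; rewrite !inE.
have H : (#|T| - size M)%:R * Ex (fun s => (all (fun x => Q (s x)) M)%:R * (Q (s e))%:R) =
    Ex (fun s => (all (fun x => Q (s x)) M)%:R *
          #|[set u | u \notin [set u | u \in M] & Q (s u)]|%:R) :> R.
  by apply: H0 => s u v; rewrite !inE => uM' vM'; rewrite all_tperm.
rewrite mulrA; apply: (canRL (mulfK _)); first by rewrite pnatr_eq0 -lt0n.
rewrite mulrC /Pr -[RHS]mulrC -[RHS]ExZ.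
transitivity ((#|T| - size M)%:R * Ex (fun s => (all (fun x => Q (s x)) M)%:R * (Q (s e))%:R) : R).
  by congr (_ * _); apply: eq_Ex => s; rewrite -natrM mulnb andbC.
apply: (etrans H); apply: eq_Ex => s.
case: (boolP (all _ M)) => [aM|]; last by rewrite mul0r mulr0.
rewrite mul1r mulr1 -(card_unused uM aM); congr (_%:R).
by apply: eq_card => u; rewrite !inE.
Qed.

Lemma ratio_le (k N i : nat) : (k <= N)%N -> (i < N)%N ->
  (k - i)%:R / (N - i)%:R <= k%:R / N%:R :> R.
Proof.
move=> kN iN; rewrite ler_pdivrMr ?ltr0n ?subn_gt0// mulrAC.
rewrite ler_pdivlMr ?ltr0n ?(leq_ltn_trans _ iN)// -!natrM ler_nat.
nia.
Qed.

(** The images of [B] are placed first, then those of [M] one at a time. The condition on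
    [size B + #|Q0|] keeps each later ratio at most [#|Q0|] over [#|T| - size B], by [ratio_le]. *)
Lemma Pr_perm_all2 Q1 Q0 B M : uniq (B ++ M) -> (size B + #|Q0| <= #|T|)%N ->
  Pr R (fun s => all (fun x => Q1 (s x)) B && all (fun x => Q0 (s x)) M) <=
  (#|Q1|%:R / #|T|%:R) ^+ size B * (#|Q0|%:R / (#|T| - size B)%:R) ^+ size M.
Proof.
move=> uBM BQ; elim: M uBM => [|e M IH] uBM.
  rewrite expr0 mulr1; rewrite cats0 in uBM.
  apply: (@le_trans _ _ (Pr R (fun s => all (fun x => Q1 (s x)) B))).
    by apply: Pr_sub => s /andP[].
  rewrite Pr_perm_all// -[X in _ ^+ X]card_ord -prodr_const.
  apply: ler_prod => i _; rewrite divr_ge0 ?ler0n//= ratio_le ?max_card//.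
  rewrite (leq_trans (ltn_ord i))// -(card_uniqP uBM) max_card//.
have /and3P[eBM uB uM] : [&& e \notin B ++ M, uniq B & uniq (B ++ M)].
  move: uBM; rewrite -cat1s uniq_catCA /= => /andP[-> u]; rewrite u.
  by move: u; rewrite cat_uniq => /andP[->].
have eB : e \notin B by move: eBM; rewrite mem_cat negb_or => /andP[].
have eM : e \notin M by move: eBM; rewrite mem_cat negb_or => /andP[].
have {}IH := IH uM.
pose f s : R := (all (fun x => Q1 (s x)) B && all (fun x => Q0 (s x)) M)%:R.
have X0 : #|~: [set u | u \in B ++ M]| = (#|T| - size B - size M)%N.
  by rewrite cardsCs setCK cardsE (card_uniqP uM) size_cat subnDA.
have X1 : (0 < #|T| - size B - size M)%N.
  by rewrite -X0; apply/card_gt0P; exists e; rewrite !inE eBM.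
have := @perm_step [set u | u \in B ++ M] f Q0 e.
rewrite inE eBM X0 => /(_ isT) H0.
have {H0} : (#|T| - size B - size M)%:R * Ex (fun s => f s * (Q0 (s e))%:R) =
    Ex (fun s => f s * #|[set u | u \notin [set u | u \in B ++ M] & Q0 (s u)]|%:R) :> R.
  apply: H0 => s u v; rewrite !inE !mem_cat !negb_or => /andP[uB' uM'] /andP[vB vM].
  by rewrite /f !all_tperm.
move=> H; apply: (@le_trans _ _ (Ex (fun s => f s * (Q0 (s e))%:R))).
  apply: Ex_le => s; rewrite /f -natrM ler_nat /=.
  by case: (all _ B); case: (Q0 _); case: (all _ M).
rewrite exprS mulrCA.
apply: (@le_trans _ _ ((#|Q0| - size M)%:R / (#|T| - size B - size M)%:R * Ex f)); last first.
  apply: ler_pM => //; first by rewrite divr_ge0 ?ler0n.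
    by apply: Ex_ge0 => s; rewrite /f ler0n.
  apply: ratio_le; [lia|lia].
rewrite mulrAC ler_pdivlMr ?ltr0n// mulrC {}H -ExZ; apply: Ex_le => s.
rewrite /f; case: (boolP (all _ M)) => [aM|]; last by rewrite andbF mul0r mulr0.
case: (all _ B); last by rewrite mul0r mulr0.
rewrite mul1r mulr1 -(card_unused _ aM) ?ler_nat; last first.
  by move: uM; rewrite cat_uniq => /and3P[].
(* Dropping [B] from the excluded points only enlarges the count. *)
by apply/subset_leq_card/subsetP => u; rewrite !inE mem_cat negb_or -andbA => /and3P[_ -> ->].
Qed.

(* [Q1] is "early" and the complement of [Q0] is "early" for another threshold.
   Writing 1 - h [early] = (1 - h) + h [late] peels off one point of A at a time,
   which replaces a negative correlation inequality. *)
Lemma Ex_perm_weight Q1 Q0 (h : T -> R) B M A :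
  uniq (B ++ M ++ A) -> (size B + #|Q0| <= #|T|)%N -> (forall e, 0 <= h e <= 1) ->
  Ex (fun s => (all (fun x => Q1 (s x)) B && all (fun x => Q0 (s x)) M)%:R *
               \prod_(e <- A) (1 - h e * (~~ Q0 (s e))%:R)) <=
  (#|Q1|%:R / #|T|%:R) ^+ size B * (#|Q0|%:R / (#|T| - size B)%:R) ^+ size M *
  \prod_(e <- A) (1 - h e * (1 - #|Q0|%:R / (#|T| - size B)%:R)).
Proof.
move=> + BQ h01; set rho := _ / (_ - _)%:R; elim: A M => [|e A IH] M uBMA.
  rewrite big_nil mulr1; under eq_Ex do rewrite big_nil mulr1.
  by apply: Pr_perm_all2 => //; move: uBMA; rewrite cats0.
rewrite big_cons; under eq_Ex do rewrite big_cons.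
pose g s := \prod_(x <- A) (1 - h x * (~~ Q0 (s x))%:R).
have /andP[h0 h1] := h01 e.
apply: (@le_trans _ _ ((1 - h e) *
   Ex (fun s => (all (fun x => Q1 (s x)) B && all (fun x => Q0 (s x)) M)%:R * g s) +
   h e * Ex (fun s => (all (fun x => Q1 (s x)) B && all (fun x => Q0 (s x)) (e :: M))%:R * g s))).
  rewrite -!ExZ -ExD; apply: Ex_le => s; rewrite -/(g s) /=.
  by case: (all _ B); case: (Q0 _); case: (all _ M); rewrite /= ?(mul0r, mulr0, mulr1, mul1r, subr0, addr0)// -mulrDl subrK mul1r.
have u1 : uniq (B ++ M ++ A).
  by apply: subseq_uniq uBMA; rewrite !cat_subseq// subseq_cons.
have u2 : uniq (B ++ (e :: M) ++ A).
  rewrite (perm_uniq (s2 := B ++ M ++ [:: e] ++ A))// perm_cat2l /= perm_sym.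
  exact: (permEl (perm_catCA M [:: e] A)).
have := IH _ u1; rewrite -/g => I1; have := IH _ u2; rewrite -/g => I2.
apply: le_trans (lerD (ler_wpM2l _ I1) (ler_wpM2l _ I2)) _ => //; first by rewrite subr_ge0.
rewrite le_eqVlt; apply/orP; left; apply/eqP; rewrite /= exprS; ring.
Qed.

(** The factor of a point [e] of [A] is expanded: the term 1 drops [e], and the term [k] moves [e]
    into [B]. As [k] is nonnegative, the induction hypothesis applies to both. *)
Lemma Ex_perm_boost Q (k : R) B A : uniq (B ++ A) -> 0 <= k ->
  Ex (fun s => (all (fun x => Q (s x)) B)%:R *
               \prod_(e <- A) (1 + k * (Q (s e))%:R)) <=
  (#|Q|%:R / #|T|%:R) ^+ size B * (1 + k * (#|Q|%:R / #|T|%:R)) ^+ size A.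
Proof.
move=> + k0; set p := _ / _; elim: A B => [|e A IH] B uBA.
  rewrite expr0 mulr1; under eq_Ex do rewrite big_nil mulr1.
  have BT : (size B + #|@pred0 T| <= #|T|)%N.
    by rewrite cats0 in uBA; rewrite card0 addn0 -(card_uniqP uBA) max_card.
  have := @Pr_perm_all2 Q pred0 B [::] uBA BT; rewrite expr0 mulr1.
  apply: le_trans.
  by apply: Ex_le => s /=; rewrite andbT.
under eq_Ex do rewrite big_cons.
pose g s := \prod_(x <- A) (1 + k * (Q (s x))%:R).
apply: (@le_trans _ _ (
   Ex (fun s => (all (fun x => Q (s x)) B)%:R * g s) +
   k * Ex (fun s => (all (fun x => Q (s x)) (e :: B))%:R * g s))).
  rewrite -!ExZ -ExD; apply: Ex_le => s; rewrite -/(g s) /=.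
  by case: (all _ B); case: (Q _); rewrite /= ?(mul0r, mulr0, mulr1, mul1r, subr0, addr0)// mulrDl mul1r.
have u1 : uniq (B ++ A).
  by apply: subseq_uniq uBA; rewrite !cat_subseq// subseq_cons.
have u2 : uniq ((e :: B) ++ A).
  by move: uBA; rewrite -cat1s uniq_catCA.
have := IH _ u1; rewrite -/g => I1; have := IH _ u2; rewrite -/g => I2.
apply: le_trans (lerD I1 (ler_wpM2l _ I2)) _ => //.
rewrite le_eqVlt; apply/orP; left; apply/eqP; rewrite /= !exprS; ring.
Qed.

End RandomPermutation.

(** * Counting edges of the complete graph *)

Section Edges.
Variable n : nat.
Implicit Types (e : edge n) (u v : 'I_n) (E : {set edge n}).

Lemma edgeP e v : v \in val e -> exists2 u, u != v & val e = [set v; u].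
Proof.
case/cards2P: (valP e) => a [b [ab]].
move=> eab; rewrite eab !inE => /orP[]/eqP->; first by exists b; rewrite // eq_sym.
by exists a; rewrite // setUC.
Qed.

Lemma mk_edge u v : u != v -> {e : edge n | val e = [set u; v]}.
Proof.
move=> uv; have h : #|[set u; v]| == 2 by rewrite cards2 uv.
by exists (exist (fun A : {set 'I_n} => #|A| == 2) _ h).
Qed.

Lemma edge_neq e u v : val e = [set u; v] -> u != v.
Proof. by move=> ee; have := valP e; rewrite /= ee cards2; case: (u != v). Qed.

Lemma set2_inj u v v' : [set u; v] = [set u; v'] -> v = v'.
Proof.
move=> h; have := set22 u v; rewrite h !inE => /orP[]/eqP// vu.
by have := set22 u v'; rewrite -h vu !inE orbb => /eqP.
Qed.

Definition edeg E (c : {ffun edge n -> bool}) v col :=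
  #|[set e in E | (v \in val e) && (c e == col)]|.

(** Each vertex outside [T] gives one edge to [v] that meets [T] in [v] alone. *)
Lemma card_star (T : {set 'I_n}) v : v \in T ->
  (n - #|T| <= #|[set e : edge n | (#|val e :&: T| == 1) && (v \in val e)]|)%N.
Proof.
move=> vT; rewrite -(card_imset _ val_inj).
have -> : (n - #|T|)%N = #|[set [set v; z] | z in ~: T]|.
  rewrite (card_imset _ (@set2_inj v)).
  by rewrite [in RHS]cardsCs setCK card_ord.
apply/subset_leq_card/subsetP => _ /imsetP[z zT ->].
have vz : v != z by apply: contraTneq zT => <-; rewrite inE negbK.
have [e ee] := mk_edge vz; apply/imsetP; exists e; rewrite // inE ee set21 andbT.
rewrite (_ : _ :&: _ = [set v]) ?cards1//; apply/setP => x; rewrite !inE.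
case: eqP => [->|_]; first by rewrite vT.
by case: eqP => [->|//]; rewrite inE in zT; rewrite (negbTE zT).
Qed.

Lemma Nedges_bin : Nedges n = 'C(n, 2).
Proof.
rewrite /Nedges card_sig; rewrite -[n in 'C(n, _)]card_ord -cardsT -cards_draws.
by apply: eq_card => A; rewrite !inE ?subsetT.
Qed.

Lemma card_inside (U : {set 'I_n}) :
  #|[set e : edge n | val e \subset U]| = 'C(#|U|, 2).
Proof.
rewrite -cards_draws -(card_imset _ val_inj); apply: eq_card => A; rewrite inE.
apply/imsetP/andP => [[e + ->]|[AU A2]]; first by rewrite inE => ->; rewrite (valP e).
by exists (exist (fun A : {set 'I_n} => #|A| == 2) _ A2); rewrite ?inE.
Qed.

Lemma card_between (S S' : {set 'I_n}) : [disjoint S & S'] ->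
  (#|S| * #|S'| <=
   #|[set e : edge n | [exists a in S, [exists b in S', val e == [set a; b]]]]|)%N.
Proof.
move=> dis; have dis' a b : a \in S -> b \in S' -> a != b.
  by move=> aS; apply: contraTneq => <-; rewrite (disjointFr dis).
rewrite -(card_imset _ val_inj) -cardsX.
rewrite -(card_in_imset (f := fun ab : 'I_n * 'I_n => [set ab.1; ab.2])).
  apply/subset_leq_card/subsetP => _ /imsetP[[a b] + ->]; rewrite inE /= => /andP[aS bS].
  have [e ee] := mk_edge (dis' _ _ aS bS); apply/imsetP; exists e; rewrite // inE.
  by apply/existsP; exists a; rewrite aS; apply/existsP; exists b; rewrite bS ee eqxx.
move=> [a b] [a' b'] /=; rewrite !inE /= => /andP[aS bS] /andP[aS' bS'] ee.
have aa : a = a'.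
  have := set21 a b; rewrite ee !inE => /orP[]/eqP// ab.
  by have := dis' _ _ aS bS'; rewrite ab eqxx.
by rewrite -aa in ee *; rewrite (set2_inj ee).
Qed.

End Edges.

(** * Exponential moments for the coloured random graph process *)

Section RandomGraph.
Variables (R : realType) (n : nat).
Implicit Types (e : edge n) (B : {set edge n}).
Local Notation Om := ({perm edge n} * {ffun edge n -> bool})%type.
Local Notation N := (Nedges n).

(** A predicate on images under the permutation: [e] is present at time [m] exactly when [s e] is
    early. Graph events thus become events of the previous part. *)
Definition early m : pred (edge n) := fun z => (enum_rank z < m)%N.

Lemma in_Eproc (s : {perm edge n}) m e : (e \in Eproc s m) = early m (s e).
Proof. by rewrite inE. Qed.

Lemma card_early m : (m <= N)%N -> #|early m| = m.
Proof.
move=> mN; rewrite -(card_imset _ (@enum_rank_inj _)).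
have winj : injective (widen_ord mN) by move=> i j /(congr1 val) /= /val_inj.
rewrite -[RHS](@card_ord m) -(card_imset _ winj) /=.
apply: eq_card => i; apply/imsetP/imsetP => [[z zm ->]|[j _ ->]].
  by exists (Ordinal (zm : (enum_rank z < m)%N)) => //; apply: val_inj.
exists (enum_val (widen_ord mN j)); last by rewrite enum_valK.
by rewrite unfold_in /early enum_valK /=.
Qed.

Lemma card_late m : (m <= N)%N -> #|predC (early m)| = (N - m)%N.
Proof. by move=> mN; have := cardC (early m); rewrite card_early// /Nedges => <-; rewrite addKn. Qed.

Lemma card_perm_gt0 (T : finType) : (0 < #|{perm T}|)%N.
Proof. by apply/card_gt0P; exists 1%g. Qed.

(** Averaging over the colours first replaces [h e] by its mean [hb e]. Then [Ex_perm_weight]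
    applies with the edges outside [B] as weighted points, since [h] vanishes on [B], and 1 - z <=
    exp (-z) turns the product into an exponential. *)
Lemma Ex_weight m1 m0 B (h : edge n -> bool -> R) :
    (m1 <= N)%N -> (m0 <= N)%N -> (#|B| <= m0)%N -> (#|B| < N)%N ->
    (forall e col, 0 <= h e col <= 1) -> (forall e col, e \in B -> h e col = 0) ->
  Ex (fun w : Om => (B \subset Eproc w.1 m1)%:R *
        \prod_e (1 - h e (w.2 e) * (e \in Eproc w.1 m0)%:R)) <=
  (m1%:R / N%:R) ^+ #|B| *
  expR (- ((m0 - #|B|)%:R / (N - #|B|)%:R / 2 * \sum_e (h e true + h e false))).
Proof.
move=> m1N m0N Bm0 BN h01 hB.
pose hb e := (h e true + h e false) / 2.
have hb01 e : 0 <= hb e <= 1.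
  by have := h01 e true; have := h01 e false; rewrite /hb; lra.
rewrite Ex_pair /=.
under eq_Ex => s.
  rewrite ExZ (Ex_ffun (fun e col => 1 - h e col * (e \in Eproc s m0)%:R)).
  rewrite (eq_bigr (fun e => 1 - hb e * (e \in Eproc s m0)%:R)); last first.
    by move=> e _; rewrite /hb; field.
  rewrite (bigID (mem B)) /= big1 ?mul1r; last first.
    by move=> e eB; rewrite /hb !hB//; ring.
  over.
have uA : uniq (enum B ++ [::] ++ enum (~: B)).
  rewrite cat_uniq !enum_uniq andbT /=; apply/hasPn => e; rewrite !mem_enum inE.
  by [].
have BQ : (size (enum B) + #|predC (early m0)| <= #|{: edge n}|)%N.
  by rewrite -cardE card_late// -/N; lia.
have := @Ex_perm_weight R _ (early m1) (predC (early m0)) hb (enum B) [::] (enum (~: B)) uA BQ hb01.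
rewrite expr0 mulr1 -!cardE card_early// card_late//.
set lhs := Ex _; move=> H; set lhs' := Ex _.
have -> : lhs' = lhs.
  apply: eq_Ex => s; congr (_%:R * _).
    congr nat_of_bool; rewrite andbT; apply/subsetP/allP => sB x.
      by rewrite mem_enum => /sB; rewrite in_Eproc.
    by move=> xB; rewrite in_Eproc; apply: sB; rewrite mem_enum.
  rewrite big_enum /=; apply: eq_big => e; first by rewrite inE.
  by rewrite in_Eproc negbK.
apply: le_trans H _; rewrite ler_wpM2l ?exprn_ge0 ?divr_ge0 ?ler0n//.
(* The worst case: all of [B] occupies early places, leaving [m0 - #|B|] of them among
   [N - #|B|]. *)
have q1 : 1 - (N - m0)%:R / (N - #|B|)%:R = (m0 - #|B|)%:R / (N - #|B|)%:R :> R.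
  have N0 : (N - #|B|)%:R != 0 :> R by rewrite pnatr_eq0 -lt0n subn_gt0.
  rewrite -[X in X - _](divff N0) -mulrBl; congr (_ / _).
  rewrite -natrB; last by lia.
  by congr (_%:R); lia.
rewrite q1; set q := _ / _; have q01 : 0 <= q <= 1.
  rewrite /q divr_ge0 ?ler0n//= ler_pdivrMr ?ltr0n ?subn_gt0// mul1r ler_nat.
  by lia.
apply: (@le_trans _ _ (\prod_(e <- enum (~: B)) expR (- (q * hb e)))).
  apply: ler_prod => e _; rewrite mulrC; have := hb01 e => hbe.
  have := expR_ge1Dx (- (q * hb e)).
  have : q * hb e <= 1 by rewrite mulr_ile1//; lra.
  by move=> *; apply/andP; split; lra.
rewrite -expR_sum ler_expR sumrN lerN2 big_enum /= -mulr_sumr -mulrA.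
rewrite ler_wpM2l//; first by lra.
rewrite mulrC mulr_suml [leLHS](bigID (mem B)) /= big1 ?add0r; last first.
  by move=> e eB; rewrite !hB// addr0 mul0r.
rewrite le_eqVlt; apply/orP; left; apply/eqP.
by apply: eq_bigl => e; rewrite inE.
Qed.

(* Exponential moment: lam ^ (number of edges of A present at time m0). *)
Lemma Pr_dense m0 (A : {set edge n}) k (lam : R) : (m0 <= N)%N -> 1 <= lam ->
  Pr R (fun w : Om => (k <= #|Eproc w.1 m0 :&: A|)%N) <=
  lam ^- k * expR (lam * (m0%:R / N%:R) * #|A|%:R).
Proof.
move=> m0N lam1.
pose f (w : Om) : R := lam ^- k * \prod_(e <- enum A) (1 + (lam - 1) * (early m0 (w.1 e))%:R).
have l0 : 0 < lam by lra.
have fE (w : Om) : f w = lam ^- k * lam ^+ #|Eproc w.1 m0 :&: A|.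
  rewrite /f; congr (_ * _); rewrite big_enum /=.
  rewrite (bigID (fun e => early m0 (w.1 e))) /= [X in _ * X]big1 ?mulr1; last first.
    by move=> e /andP[_ /negbTE ->]; rewrite mulr0 addr0.
  rewrite -prodr_const; apply: eq_big => e; first by rewrite in_setI in_Eproc andbC.
  by move=> /andP[_ ->] /=; ring.
apply: (@le_trans _ _ (Ex f)).
  apply: Pr_Ex => w; rewrite fE; first by rewrite mulr_ge0 ?invr_ge0 ?exprn_ge0//; lra.
  move=> kA; rewrite mulrC ler_pdivlMr ?exprn_gt0// mul1r.
  exact: ler_weXn2l.
rewrite /f ExZ Ex_pair ler_wpM2l ?invr_ge0 ?exprn_ge0//; first by lra.
pose g (s : {perm edge n}) : R := \prod_(e <- enum A) (1 + (lam - 1) * (early m0 (s e))%:R).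
rewrite (eq_Ex (g := g)); last first.
  by move=> s; rewrite /= Ex_cst// card_ffun card_bool expn_gt0.
have := @Ex_perm_boost R _ (early m0) (lam - 1) [::] (enum A).
rewrite /= enum_uniq subr_ge0 => /(_ isT lam1); rewrite expr0 mul1r -cardE card_early//.
under eq_Ex do rewrite mul1r.
move=> H; apply: le_trans H _.
rewrite [_ * #|A|%:R]mulrC expRM_natl.
have p0 : 0 <= m0%:R / N%:R :> R by rewrite divr_ge0 ?ler0n.
have p1 : 0 <= (lam - 1) * (m0%:R / N%:R) by rewrite mulr_ge0// subr_ge0.
apply: lerXn2r; rewrite ?nnegrE ?expR_ge0//; first by rewrite addr_ge0.
by apply: le_trans (expR_ge1Dx _) _; rewrite ler_expR mulrBl mul1r lerBlDr lerDl.
Qed.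

End RandomGraph.

(** * Vertices with few edges of a given colour *)

Section DeficientVertices.
Variables (R : realType) (n : nat).
Local Notation Om := ({perm edge n} * {ffun edge n -> bool})%type.
Local Notation N := (Nedges n).

(** An edge counted here has a single endpoint in [T], so for each colour it serves at most one pair
    of [P]. By [card_star], each pair is served by at least [n - #|T|] edges. *)
Lemma deficient_weight (T : {set 'I_n}) (P : {set 'I_n * bool}) :
    (forall vc, vc \in P -> vc.1 \in T) ->
  (#|P| * (n - #|T|) <= \sum_(e : edge n) \sum_(col : bool)
     ((#|val e :&: T| == 1) && [exists v in val e, (v, col) \in P]))%N.
Proof.
move=> PT; rewrite -sum_nat_const.
apply: (@leq_trans (\sum_(vc in P) \sum_(e : edge n)
          ((#|val e :&: T| == 1) && (vc.1 \in val e)))).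
  apply: leq_sum => vc vcP; apply: leq_trans (card_star (PT _ vcP)) _.
  rewrite -sum1_card big_mkcond; apply: leq_sum => e _.
  by rewrite inE; case: ifP.
rewrite exchange_big; apply: leq_sum => e _.
case: eqP => [/eqP/cards1P[z eT]|_]; last by rewrite big1.
apply: (@leq_trans (\sum_(vc in P) \sum_(col : bool)
          ((vc.1 \in val e) && (col == vc.2)))).
  apply: leq_sum => vc _ /=; rewrite big_bool.
  by case: (_ \in _); case: vc => ? [].
rewrite exchange_big; apply: leq_sum => col _ /=.
case: existsP => [_|H].
  rewrite -big_mkcondr sum1_card.
  apply: (@leq_trans #|[set (z, col)]|); last by rewrite cards1.
  apply/subset_leq_card/subsetP => -[v c'].
  rewrite !inE /= => /and3P[/PT /= vT ve /eqP->]; apply/eqP; congr (_, _).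
  by apply/set1P; rewrite -eT inE ve.
rewrite big1 // => -[v c'] /= vcP; apply/eqP; rewrite eqb0.
apply/negP => /andP[ve /eqP cc]; apply: H; exists v.
by rewrite ve cc.
Qed.

(* Exponential moment with parameter exp (-3): each pair of P weighs the edges
   from its vertex to the outside of T, so that no edge is weighed twice for the
   same colour. *)
Lemma Pr_deficient m1 m0 (T : {set 'I_n}) (B : {set edge n})
    (P : {set 'I_n * bool}) K :
    (m1 <= N)%N -> (m0 <= N)%N -> (#|B| <= m0)%N -> (#|B| < N)%N ->
    (forall e, e \in B -> val e \subset T) -> (forall vc, vc \in P -> vc.1 \in T) ->
  Pr R (fun w : Om => (B \subset Eproc w.1 m1) &&
     [forall vc in P, edeg (Eproc w.1 m0) w.2 vc.1 vc.2 <= K]%N) <=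
  expR 3 ^+ (#|P| * K) * ((m1%:R / N%:R) ^+ #|B| *
  expR (- ((m0 - #|B|)%:R / (N - #|B|)%:R / 2 * (1 - expR (- 3)) * (#|P| * (n - #|T|))%:R))).
Proof.
move=> m1N m0N Bm0 BN BT PT.
pose hh (e : edge n) col := (#|val e :&: T| == 1) && [exists v in val e, (v, col) \in P].
pose h (e : edge n) col : R := (1 - expR (- 3)) * (hh e col)%:R.
have l1 : 0 < (expR (- 3) : R) <= 1.
  by rewrite expR_gt0 /= expR_le1; lra.
have h01 e col : 0 <= h e col <= 1 by rewrite /h; case: (hh _ _) => /=; lra.
have hB e col : e \in B -> h e col = 0.
  move=> eB; rewrite /h /hh (setIidPl (BT e eB)) (eqP (valP e)) /=.
  by rewrite mulr0.
have := Ex_weight m1N m0N Bm0 BN h01 hB.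
set g := fun w : Om => _; move=> H.
apply: (@le_trans _ _ (expR 3 ^+ (#|P| * K) * Ex g)); last first.
  rewrite ler_wpM2l ?exprn_ge0 ?expR_ge0//; apply: le_trans H _.
  rewrite ler_wpM2l ?exprn_ge0 ?divr_ge0 ?ler0n//.
  rewrite ler_expR lerN2 -mulrA ler_wpM2l ?divr_ge0 ?ler0n//.
  have -> : \sum_e (h e true + h e false) =
     (1 - expR (- 3)) * (\sum_(e : edge n) \sum_(col : bool) hh e col)%:R.
    rewrite natr_sum mulr_sumr; apply: eq_bigr => e _.
    by rewrite big_bool natrD mulrDr.
  rewrite ler_wpM2l//; first by lra.
  by rewrite ler_nat deficient_weight.
rewrite -ExZ; apply: Pr_Ex => w.
  rewrite mulr_ge0 ?exprn_ge0 ?expR_ge0// /g mulr_ge0 ?ler0n// prodr_ge0// => e _.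
  case/andP: (h01 e (w.2 e)) => x0 x1; rewrite subr_ge0.
  by case: (e \in _); rewrite ?mulr1 ?mulr0 ?ler01.
move=> /andP[wB /forallP wP]; rewrite /g wB mul1r.
pose x (e : edge n) : nat := hh e (w.2 e) && (e \in Eproc w.1 m0).
(* The factor is exp (-3) on a counted edge and 1 elsewhere. On the event, at most [#|P| * K] edges
   are counted, as each lies in the coloured star of some pair of [P]. *)
rewrite (eq_bigr (fun e => expR (- 3) ^+ x e)); last first.
  move=> e _; rewrite /h /x; by case: (hh _ _); case: (e \in _); rewrite ?(expr1, expr0, mulr1, mulr0, subr0) ?subKr.
rewrite prodrXr expRN exprVn ler_pdivlMr ?exprn_gt0 ?expR_gt0// mul1r.
apply: ler_weXn2l; first by by rewrite ltW// expR_gt1 ltr0n.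
rewrite -sum_nat_const.
apply: (@leq_trans (\sum_(vc in P) edeg (Eproc w.1 m0) w.2 vc.1 vc.2)); last first.
  by apply: leq_sum => vc vcP; apply: (implyP (wP vc)).
apply: (@leq_trans (\sum_(vc in P) \sum_(e : edge n)
   (e \in [set e in Eproc w.1 m0 | (vc.1 \in val e) && (w.2 e == vc.2)]))); last first.
  by apply: leq_sum => vc _; rewrite /edeg -sum1_card [leqRHS]big_mkcond; apply: leq_sum => e _; case: (_ \in _).
rewrite exchange_big; apply: leq_sum => e _.
rewrite /x; case: (boolP (_ && _)) => // /andP[/andP[_ /existsP[v /andP[ve vP]]] eE].
by rewrite (bigD1 (v, w.2 e))//= inE eE ve eqxx.
Qed.

End DeficientVertices.

Lemma disjointsU (T : finType) (A B C : {set T}) :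
  [disjoint A & C] -> [disjoint B & C] -> [disjoint A :|: B & C].
Proof.
by rewrite -!setI_eq0 setIUl => /eqP-> /eqP->; rewrite setU0.
Qed.

(** * Building zebraic paths by extension and joining *)

Section AlternatingPaths.
Variables (n : nat) (G : {set edge n}) (c : {ffun edge n -> bool}).
Implicit Types (x y u v w r : 'I_n) (p : seq 'I_n) (col : bool) (V : {set 'I_n}).

Local Notation neqb := (fun a b : bool => a != b).

Lemma adj_sym u v : adj G u v = adj G v u.
Proof. by rewrite /adj setUC. Qed.

Lemma ecol_sym u v : ecol c u v = ecol c v u.
Proof. by rewrite /ecol setUC. Qed.

Lemma ecolE (e : edge n) u v : val e = [set u; v] -> ecol c u v = c e.
Proof.
move=> ee; apply/existsP/idP => [[f /andP[/eqP fe cf]]|ce].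
  by rewrite (_ : e = f)//; apply: val_inj; rewrite ee.
by exists e; rewrite ee eqxx.
Qed.

Lemma adjE (e : edge n) u v : e \in G -> val e = [set u; v] -> adj G u v.
Proof. by move=> eG ee; apply/existsP; exists e; rewrite eG ee eqxx. Qed.

Lemma pairmap_rev (f : 'I_n -> 'I_n -> bool) x p : (forall u v, f u v = f v u) ->
  pairmap f (last x p) (rev (belast x p)) = rev (pairmap f x p).
Proof.
move=> fC; elim: p x => [//|a s IH] x /=.
rewrite rev_cons -cats1 pairmap_cat IH /= rev_cons -cats1 fC.
congr (_ ++ [:: f _ _]); case: s {IH} => [//|b s] /=.
by rewrite rev_cons last_rcons.
Qed.

(** The default [~~ col] of [last] excludes an empty [s], so [col] is the colour of a genuine last
    edge. *)
Lemma sorted_neq_rcons (s : seq bool) col : sorted neqb s ->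
  last (~~ col) s = col -> sorted neqb (rcons s (~~ col)).
Proof.
case: s => [|a s] //= ss sc; rewrite rcons_path ss sc.
by case: col {sc}.
Qed.

Lemma sorted_neq_join (s s' : seq bool) col :
    sorted neqb s -> last (~~ col) s = col ->
    sorted neqb s' -> last (~~ col) s' = col ->
  sorted neqb (s ++ ~~ col :: rev s').
Proof.
case: s => [_|a s] /=; first by case: col.
move=> ss sc ss' sc'; rewrite cat_path ss /= sc.
apply/andP; split; first by case: col {sc sc'}.
have := sorted_neq_rcons ss' sc'; rewrite -[rcons _ _]revK rev_sorted rev_rcons /=.
by rewrite (eq_path (e' := neqb)) // => b b'; rewrite eq_sym.
Qed.

(** A nonempty zebraic path from [x] to [v] inside [V] with last edge coloured [col]; the default of
    [last] again excludes the empty path. *)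
Definition reach V x v col := exists p,
  [/\ uniq (x :: p) /\ {subset x :: p <= V}, last x p = v, path (adj G) x p,
      sorted neqb (pairmap (ecol c) x p) &
      last (~~ col) (pairmap (ecol c) x p) = col].

Lemma reach_edge (e : edge n) x w : e \in G -> val e = [set x; w] ->
  reach [set x; w] x w (c e).
Proof.
move=> eG ee; exists [:: w]; split => //=.
- split; first by rewrite inE andbT (edge_neq ee).
  by move=> z; rewrite !inE.
- by rewrite andbT (adjE eG ee).
- by rewrite (ecolE ee).
Qed.

(** The whole layer [R] is added to [V], not only [r], so that the paths to all vertices of a layer
    are confined to one common set. *)
Lemma reach_extend V (R : {set 'I_n}) (e : edge n) x v r col :
    reach V x v col -> e \in G -> val e = [set v; r] -> c e = ~~ col ->
    r \in R -> [disjoint R & V] ->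
  reach (V :|: R) x r (~~ col).
Proof.
move=> [p [[up pV] lp pp sp cp]] eG ee ce rR dis.
have rp : r \notin x :: p by apply/negP => /pV; rewrite (disjointFr dis).
have cE : pairmap (ecol c) x (rcons p r) = rcons (pairmap (ecol c) x p) (~~ col).
  by rewrite -cats1 pairmap_cat lp /= (ecolE ee) ce cats1.
exists (rcons p r); rewrite cE; split.
- rewrite -rcons_cons rcons_uniq rp up; split => // z.
  by rewrite mem_rcons !inE => /orP[/eqP->|/pV ->]; rewrite ?rR ?orbT.
- exact: last_rcons.
- by rewrite rcons_path pp lp (adjE eG ee).
- exact: sorted_neq_rcons.
- exact: last_rcons.
Qed.

(** The second path is traversed backwards after [e]. Both paths end in [col], so the opposite
    colour of [e] alternates on either side, and disjointness of [V] and [V'] makes the result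
    simple. *)
Lemma reach_join V V' (e : edge n) x v y v' col :
    reach V x v col -> reach V' y v' col -> [disjoint V & V'] ->
    e \in G -> val e = [set v; v'] -> c e = ~~ col ->
  zebraic_path G c x y.
Proof.
move=> [p [[up pV] lp pp sp cp]] [q [[uq qV] lq pq sq cq]] dis eG ee ce.
exists (p ++ last y q :: rev (belast y q)).
have rq : last y q :: rev (belast y q) = rev (y :: q) by rewrite [in RHS]lastI rev_rcons.
split.
- rewrite rq -cat_cons cat_uniq up rev_uniq uq andbT.
  apply/hasPn => z; rewrite mem_rev => /qV zV'; apply/negP => /pV zV.
  by have := disjointFr dis zV; rewrite zV'.
- rewrite last_cat; case: q {sq pq uq qV rq lq} cq => [/= H|a q _ /=]; first by case: (col) H.
  by rewrite rev_cons last_rcons.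
- rewrite cat_path pp /= lp lq (adjE eG ee) /= -lq rev_path.
  by rewrite (eq_path (e' := adj G)) // => a b; rewrite adj_sym.
- rewrite pairmap_cat /= (pairmap_rev _ _ ecol_sym) lp lq (ecolE ee) ce.
  exact: sorted_neq_join.
Qed.

Lemma zebraic_edge (e : edge n) x y : e \in G -> val e = [set x; y] -> zebraic_path G c x y.
Proof.
move=> eG ee; exists [:: y]; split => //=; last by rewrite andbT (adjE eG ee).
by rewrite inE andbT (edge_neq ee).
Qed.

End AlternatingPaths.

(** * Growing two disjoint trees of rich vertices, for a fixed coloured graph *)

Section Expansion.
Variables (n : nat) (D G : {set edge n}) (c : {ffun edge n -> bool}).
Variables (t u0 s0 : nat).
Local Notation K := (16 * t + 2)%N.
Implicit Types (x y u v w r : 'I_n) (col : bool) (V L W R S U : {set 'I_n}).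

Definition rich K' v := [forall col, K' < edeg D c v col]%N.
(* A poor vertex has few edges of both colours: stronger than not being rich. *)
Definition poor K' v := [forall col, edeg D c v col <= K']%N.
(** Despite the name, the other endpoint is only asked not to be [rich]; it may fail to be
    [poor]. *)
Definition poor_edges K' v :=
  [set e in D | (v \in val e) && [exists w in val e, (w != v) && ~~ rich K' w]].
Local Notation rch := (rich K).

Hypothesis DG : D \subset G.
Hypothesis degG : mindeg_ge1 G.
Hypothesis few_poor : forall v, (#|poor_edges K v| <= 2)%N.
Hypothesis poor_nbr : forall (e : edge n) v w, e \in G -> val e = [set v; w] ->
  poor K v -> rch w.
Hypothesis poor_cherry : forall (e f : edge n) x w y, e \in G -> f \in G ->
  val e = [set x; w] -> val f = [set w; y] -> x != y -> poor K x -> rch y.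
Hypothesis sparse : forall U, (0 < #|U| <= u0)%N ->
  (#|D :&: [set e : edge n | val e \subset U]| < t * #|U|)%N.
Hypothesis joined : forall S S' col, [disjoint S & S'] ->
  (s0 <= #|S|)%N -> (s0 <= #|S'|)%N ->
  exists e a b, [/\ e \in D, c e = col, a \in S, b \in S' & val e = [set a; b]].
Hypothesis t0 : (0 < t)%N.
Hypothesis s00 : (0 < s0)%N.
Hypothesis su0 : (16 * s0 <= u0)%N.

Lemma rich_notpoor v : rch v -> ~~ poor K v.
Proof.
move=> /forallP/(_ true) h; apply/negP => /forallP/(_ true).
by rewrite leqNgt h.
Qed.

(** At most two edges at [v] lead to vertices that are not rich, so one of any three leads to a rich
    vertex. *)
Lemma rich_edge (A : {set edge n}) v : A \subset D -> (forall e, e \in A -> v \in val e) ->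
  (2 < #|A|)%N -> exists2 e, e \in A & forall w, val e = [set v; w] -> rch w.
Proof.
move=> AD Av A2; have /card_gt0P[e] : (0 < #|A :\: poor_edges K v|)%N.
  have := cardsID (poor_edges K v) A.
  have := subset_leq_card (subsetIr A (poor_edges K v)).
  have := few_poor v; lia.
rewrite !inE => /andP[+ eA]; rewrite (subsetP AD) // (Av e)// => ne; exists e; first exact: eA. move=> w ee.
apply: contraNT ne => nw; apply/existsP; exists w.
by rewrite ee set22 nw eq_sym (edge_neq ee).
Qed.

(** A poor [v] has some edge in [G] by the minimum degree, and its other end is rich by [poor_nbr].
    Any other [v] has many edges of one colour in [D], and [rich_edge] applies. *)
Lemma rich_nbr v : exists (e : edge n) w, [/\ e \in G, val e = [set v; w] & rch w].
Proof.
have [e /andP[eG ve]] : exists e, (e \in G) && (v \in val e).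
  by have /forallP/(_ v)/existsP := degG.
have [w _ ee] := edgeP ve.
have [pv|npv] := boolP (poor K v); first by exists e, w; split => //; apply: (poor_nbr eG ee).
have /existsP[col] : [exists col, K < edeg D c v col]%N.
  by move: npv; rewrite negb_forall => /existsP[col]; rewrite -ltnNge => ?; apply/existsP; exists col.
move=> Kv; have [|||f fA fr] := @rich_edge [set e in D | (v \in val e) && (c e == col)] v.
- by apply/subsetP => f; rewrite inE => /andP[].
- by move=> f; rewrite inE => /and3P[].
- by move: Kv; rewrite /edeg; lia.
move: fA; rewrite inE => /and3P[fD vf _]; have [z _ fe] := edgeP vf.
by exists f, z; split; [apply: (subsetP DG)| |apply: fr].
Qed.

Lemma rich_nbr2 v u : ~~ poor K v -> exists (e : edge n) w,
  [/\ e \in G, val e = [set v; w], rch w & w != u].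
Proof.
rewrite negb_forall => /existsP[col]; rewrite -ltnNge => Kv.
pose A := [set e in D | (v \in val e) && (c e == col)].
pose B := [set e : edge n | val e == [set v; u]].
have B1 : (#|B| <= 1)%N.
  by apply/card_le1_eqP => e f; rewrite !inE => /eqP ee /eqP fe; apply: val_inj; rewrite ee.
have [|||f fA fr] := @rich_edge (A :\: B) v.
- by apply/subsetP => f; rewrite !inE => /and4P[].
- by move=> f; rewrite !inE => /and4P[].
- have KA : (16 * t + 2 < #|A|)%N := Kv.
  have BA := leq_trans (subset_leq_card (subsetIr A B)) B1.
  by rewrite -(ltn_add2l #|A :&: B|) cardsID; apply: leq_ltn_trans KA; lia.
move: fA; rewrite !inE => /and4P[fB fD vf _]; have [z _ fe] := edgeP vf.
exists f, z; split; [exact: (subsetP DG)|by []|exact: fr|].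
by apply: contraNneq fB => <-; rewrite fe.
Qed.

(** If both chosen neighbours coincide, [x] and [y] are at distance two. Then [poor_cherry] makes
    [y] rich when [x] is poor, so one of the two is not poor and has a second rich neighbour by
    [rich_nbr2]. *)
Lemma rich_nbrs x y : x != y -> ~~ adj G x y ->
  exists (e f : edge n) w z, [/\ e \in G, f \in G, val e = [set x; w] & val f = [set y; z]] /\
    [/\ rch w, rch z & w != z].
Proof.
move=> xy nxy; have [e [w [eG ee rw]]] := rich_nbr x.
have [f [z [fG fe rz]]] := rich_nbr y.
have [wz|wz] := eqVneq w z; last by exists e, f, w, z.
subst z; have [px|npx] := boolP (poor K x).
  have ry : rch y by apply: poor_cherry px => //; [exact: eG|exact: fG|exact: ee|by rewrite setUC].
  have [f' [z [f'G f'e rz' zw]]] := rich_nbr2 w (rich_notpoor ry).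
  by exists e, f', w, z; rewrite eq_sym zw.
have [e' [z [e'G e'e rz' zw]]] := rich_nbr2 w npx.
by exists e', f, z, w.
Qed.

(** Let [R0] be the set of candidates. If it had fewer than [2 * #|L|] elements, [V :|: R0] would
    have at most [8 * #|L|] vertices, hence be subject to [sparse], while containing nearly all
    edges of colour [col] at [L]. *)
Lemma expand V L col : L \subset V -> {in L, forall v, rch v} -> (0 < #|L|)%N ->
    (#|V| <= 6 * #|L|)%N -> (8 * #|L| <= u0)%N ->
  exists R, [/\ [disjoint R & V], #|R| = (2 * #|L|)%N, {in R, forall r, rch r} &
    forall r, r \in R -> exists (e : edge n) v,
      [/\ v \in L, e \in D, c e = col & val e = [set v; r]]].
Proof.
move=> LV Lr L0 VL Lu.
pose R0 := [set r | [&& r \notin V, rch r & [exists v in L, [exists e in D,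
              (c e == col) && (val e == [set v; r])]]]].
suff R0L : (2 * #|L| <= #|R0|)%N.
  have : (0 < #|[set A : {set 'I_n} | A \subset R0 & #|A| == (2 * #|L|)%N]|)%N.
    by rewrite cards_draws bin_gt0.
  move=> /card_gt0P[R]; rewrite inE => /andP[/subsetP RR0 /eqP cR].
  exists R; split => //.
  - by rewrite disjoint_subset; apply/subsetP => r /RR0; rewrite !inE => /and3P[].
  - by move=> r /RR0; rewrite !inE => /and3P[].
  - move=> r /RR0; rewrite !inE => /and3P[_ _ /existsP[v /andP[vL /existsP[e /and3P[eD /eqP ce /eqP ee]]]]].
    by exists e, v.
rewrite leqNgt; apply/negP => R0L.
pose U := V :|: R0.
have Uc : (#|U| <= 8 * #|L|)%N by apply: leq_trans (leq_card_setU _ _) _; lia.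
have U0 : (0 < #|U| <= u0)%N.
  have := subset_leq_card (subset_trans LV (subsetUl V R0)); rewrite -/U.
  by move: Uc Lu L0; clear; lia.
have := sparse U0; set E := _ :&: _ => EU.
(* Of the at least [K + 1] edges at [v], at most two lead to vertices that are not rich; the others
   stay inside [U], and [K - 1 = 16 * t + 1]. *)
have LE : (\sum_(v in L) (K - 1) <= \sum_(v in L) #|[set e in E | v \in val e]|)%N.
  apply: leq_sum => v vL.
  have := Lr v vL; move=> /forallP/(_ col); rewrite /edeg; set A := [set e in D | _] => KA.
  apply: (@leq_trans #|A :\: poor_edges K v|).
    have := cardsID (poor_edges K v) A.
    have := subset_leq_card (subsetIr A (poor_edges K v)).
    by have := few_poor v; lia.
  apply/subset_leq_card/subsetP => e; rewrite !inE => /and4P[ne eD ve ce].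
  rewrite eD ve andbT /=; have [w wv ee] := edgeP ve; rewrite ee.
  apply/subsetP => z; rewrite !inE => /orP[/eqP->|/eqP->]; first by rewrite (subsetP LV).
  have [//|wV] /= := boolP (w \in V).
  have rw : rch w.
    apply: contraNT ne => nw; rewrite eD ve /=.
    by apply/existsP; exists w; rewrite ee set22 wv.
  rewrite rw /=; apply/existsP; exists v; rewrite vL /=.
  by apply/existsP; exists e; rewrite eD ce ee eqxx.
have E2 : (\sum_(v in L) #|[set e in E | v \in val e]| <= 2 * #|E|)%N.
  rewrite mulnC -sum_nat_const.
  under eq_bigr do rewrite -sum1_card.
  rewrite (exchange_big_dep (mem E)) /=; last by move=> v e _; rewrite inE => /andP[].
  apply: leq_sum => e _; rewrite sum1_card -[leqRHS](eqP (valP e)).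
  by apply/subset_leq_card/subsetP => v; rewrite unfold_in /= => /andP[_]; rewrite inE => /andP[].
move: LE; rewrite sum_nat_const => LE.
have := leq_trans LE E2.
(* The contradiction reads (16 t + 1) |L| <= 2 |E| < 2 t |U| <= 16 t |L|. *)
move: EU Uc L0; clear; nia.
Qed.

Definition tree V L x col := L \subset V /\
  forall v, v \in L -> rch v /\ reach G c V x v col.

(** [W] stands for the other tree. Applying [expand] to [V :|: W] keeps the new layer away from
    both. *)
Lemma tree_grow V W L x col : tree V L x col -> [disjoint V & W] -> (0 < #|L|)%N ->
    (#|V| + #|W| <= 6 * #|L|)%N -> (8 * #|L| <= u0)%N ->
  exists R, [/\ [disjoint R & V], [disjoint R & W], #|R| = (2 * #|L|)%N &
    tree (V :|: R) R x (~~ col)].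
Proof.
move=> [LV tV] dis L0 VL Lu.
have [|||R [RV cR Rr RL]] := @expand (V :|: W) L (~~ col) _ _ L0 _ Lu.
- exact: subset_trans LV (subsetUl _ _).
- by move=> v /tV[].
- exact: leq_trans (leq_card_setU _ _) VL.
have RV' : [disjoint R & V] by apply: disjointWr RV; exact: subsetUl.
exists R; split => //; first by apply: disjointWr RV; exact: subsetUr.
split; first exact: subsetUr.
move=> r rR; split; first exact: Rr.
have [e [v [vL eD ce ee]]] := RL r rR.
by apply: reach_extend (tV v vL).2 _ ee ce rR RV'; exact: (subsetP DG).
Qed.

(* The bound 4 k on the visited vertices leaves room for |V| + |V'| <= 6 k after
   one of the two trees has been extended. *)
Definition grown x y k cx cy := exists V V' L L',
  [/\ [disjoint V & V'], tree V L x cx, tree V' L' y cy, #|L| = k /\ #|L'| = k &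
      (#|V| + #|V'| <= 4 * k)%N].

(** The first tree grows avoiding the second, then the second grows avoiding the enlarged first; the
    total rises from 4 k to at most 8 k, which is 4 (2 k). *)
Lemma grown_double x y k cx cy : (0 < k)%N -> (8 * k <= u0)%N ->
  grown x y k cx cy -> grown x y (2 * k) (~~ cx) (~~ cy).
Proof.
move=> k0 ku [V [V' [L [L' [dis tL tL' [Lk L'k] Vk]]]]].
have [|||R [RV RV' cR tR]] := tree_grow tL dis; try by rewrite Lk; lia.
have dis' : [disjoint V' & V :|: R].
  rewrite disjoint_sym disjointsU//.
have cVR : (#|V :|: R| <= #|V| + 2 * k)%N.
  by rewrite -Lk -cR leq_card_setU.
have [|||R' [R'V' R'VR cR' tR']] := tree_grow tL' dis'; try by rewrite L'k; lia.
exists (V :|: R), (V' :|: R'), R, R'; split => //.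
- by rewrite disjoint_sym disjointsU// disjoint_sym.
- by rewrite cR cR' Lk L'k.
- apply: leq_trans (leq_add cVR (leq_card_setU _ _)) _; rewrite cR' L'k; lia.
Qed.

Lemma grown_iter x y cx cy i : grown x y 1 cx cy -> (8 * 2 ^ i <= u0)%N ->
  grown x y (2 ^ i) (cx (+) odd i) (cy (+) odd i).
Proof.
move=> g1; elim: i => [|i IH] iu; first by rewrite /= !addbF.
rewrite expnS in iu *; have iu' : (8 * 2 ^ i <= u0)%N by lia.
by rewrite /= !addbN; apply: grown_double => //; rewrite ?expn_gt0//; exact: IH.
Qed.

Lemma grown_join x y k cx cy : (s0 <= k)%N -> (8 * k <= u0)%N ->
  grown x y k cx cy -> zebraic_path G c x y.
Proof.
move=> sk ku [V [V' [L [L' [dis tL tL' [Lk L'k] Vk]]]]].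
have LV' : [disjoint V & L'] by apply: disjointWr dis; exact: tL'.1.
have [cc|cc] := eqVneq cx cy.
  have [|||e [a [b [eD ce aL bL ee]]]] := @joined L L' (~~ cx); rewrite ?Lk ?L'k//.
    by apply: disjointWl LV'; exact: tL.1.
  apply: reach_join (tL.2 a aL).2 _ dis (subsetP DG _ eD) ee ce.
  by rewrite cc; exact: (tL'.2 b bL).2.
(* Here [cy] is [~~ cx]. One more layer of the first tree also ends in [~~ cx], so the joining edge
   must have colour [cx]. *)
have [|||R [RV RV' cR tR]] := tree_grow tL dis; try by rewrite Lk; lia.
have [|||e [a [b [eD ce aL bL ee]]]] := @joined R L' cx; rewrite ?cR ?Lk ?L'k//; [|lia|].
  by apply: disjointWr RV'; exact: tL'.1.
have ccy : cy = ~~ cx by move: cc; case: (cx); case: (cy).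
apply: reach_join (tR.2 a aL).2 _ _ (subsetP DG _ eD) ee _; last by rewrite ce negbK.
  by rewrite -ccy; exact: (tL'.2 b bL).2.
by rewrite disjointsU.
Qed.

Lemma zebraic_connected x y : x <> y -> zebraic_path G c x y.
Proof.
move=> /eqP xy; have [|nxy] := boolP (adj G x y).
  by move=> /existsP[e /andP[eG /eqP ee]]; exact: zebraic_edge eG ee.
have [e [f [w [z [[eG fG ee fe] [rw rz wz]]]]]] := rich_nbrs xy nxy.
(* Non-adjacency of [x] and [y] makes the starting sets [[set x; w]] and [[set y; z]] disjoint;
   their total size is at most 4, as [grown] asks for [k = 1]. *)
have wy : w != y by apply: contraNneq nxy => <-; exact: adjE eG ee.
have zx : z != x by apply: contraNneq nxy => <-; rewrite adj_sym; exact: adjE fG fe.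
have g1 : grown x y 1 (c e) (c f).
  exists [set x; w], [set y; z], [set w], [set z]; split.
  - rewrite disjoint_subset; apply/subsetP => v; rewrite !inE negb_or.
    by move=> /orP[]/eqP->; rewrite ?xy ?wy ?wz// eq_sym zx.
  - split; first by rewrite sub1set set22.
    by move=> v /set1P->; split => //; exact: reach_edge.
  - split; first by rewrite sub1set set22.
    by move=> v /set1P->; split => //; exact: reach_edge.
  - by rewrite !cards1.
  - by rewrite !cards2; case: (_ != _); case: (_ != _).
(* The least [i] with [s0 <= 2 ^ i] satisfies [2 ^ i <= 2 * s0], so [su0] allows growth up to that
   layer. *)
have := @up_logP 2 s0 isT.
set i := up_log 2 s0 => si.
have i2 : (2 ^ i <= 2 * s0)%N.
  have [s1|s1] := leqP s0 1; first have /eqP -> : i == 0%N by rewrite up_log_eq0 s1.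
    by move: s00; clear; lia.
  have := up_log_bounds (isT : 1 < 2)%N s1; rewrite -/i => /andP[+ _].
  have : (0 < i)%N by rewrite /i up_log_gt0.
  case: (i) => // j _ /=; rewrite expnS => /ltnW.
  by rewrite leq_mul2l.
have i8 : (8 * 2 ^ i <= u0)%N by move: su0 i2; clear; lia.
exact: grown_join si i8 (grown_iter g1 i8).
Qed.

End Expansion.

(** * Stars of one and of two vertices *)

Section MoreEdges.
Variable n : nat.
Implicit Types (u v : 'I_n).

Lemma card_star1 v : #|[set e : edge n | v \in val e]| = n.-1.
Proof.
rewrite -(card_imset _ val_inj).
have -> : n.-1 = #|[set [set v; z] | z in ~: [set v]]|.
  rewrite (card_imset _ (@set2_inj _ v)).
  by rewrite [in RHS]cardsCs setCK card_ord cards1 subn1.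
apply: eq_card => A; apply/imsetP/imsetP => [[e + ->]|[z + ->]].
  rewrite inE => ve; have [u uv ee] := edgeP ve.
  by exists u => //; rewrite !inE.
rewrite !inE => zv; have [|e ee] := @mk_edge _ v z; first by rewrite eq_sym.
by exists e => //; rewrite inE ee set21.
Qed.

Lemma card_star2 u v : u != v ->
  #|[set e : edge n | u \in val e] :|: [set e : edge n | v \in val e]| = (n.-1 + n.-1 - 1)%N.
Proof.
move=> uv; rewrite cardsU !card_star1; congr (_ - _)%N.
have [e ee] := mk_edge uv; apply: (@etrans _ _ #|[set e]|); last by rewrite cards1.
apply: eq_card => f; rewrite !inE; apply/andP/eqP => [[uf vf]|->]; last first.
  by rewrite ee set21 set22.
apply: val_inj; rewrite ee; have [w wu fe] := edgeP uf.
by move: vf; rewrite fe !inE eq_sym (negbTE uv) /= => /eqP->.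
Qed.

Lemma mindegN (E : {set edge n}) :
  ~~ mindeg_ge1 E -> exists v, forall e : edge n, v \in val e -> e \notin E.
Proof.
rewrite negb_forall => /existsP[v]; rewrite negb_exists => /forallP H.
exists v => e ve; apply/negP => eE; have := H e.
by rewrite eE ve.
Qed.

End MoreEdges.

Lemma leq_bin_exp n m : ('C(n, m) <= n ^ m)%N.
Proof.
apply: (@leq_trans (n ^_ m)).
  by rewrite -bin_ffact leq_pmulr// fact_gt0.
elim: m => [|m IH]; first by rewrite ffactn0.
by rewrite ffactnSr expnSr leq_mul// leq_subr.
Qed.

(** * First and second moments of the number of isolated vertices *)

Section IsolatedVertices.
Variables (R : realType) (n : nat).
Local Notation N := (Nedges n).
Local Notation Om := ({perm edge n} * {ffun edge n -> bool})%type.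

Definition isolated m (s : {perm edge n}) (v : 'I_n) : bool :=
  all (fun e => predC (early m) (s e)) (enum [set e : edge n | v \in val e]).

Lemma isolatedP m s v : reflect (forall e : edge n, v \in val e -> e \notin Eproc s m) (isolated m s v).
Proof.
apply: (iffP allP) => H e; first by move=> ve; rewrite in_Eproc; apply: H; rewrite mem_enum inE.
by rewrite mem_enum inE => /H; rewrite in_Eproc.
Qed.

(** The hypergeometric probability that [a] given edges are all absent after [m] steps. *)
Definition late_prob m a : R := \prod_(i < a) ((N - m - i)%:R / (N - i)%:R).

Lemma Pr_late m (A : {set edge n}) : (m <= N)%N ->
  Pr R (fun s : {perm edge n} => all (fun e => predC (early m) (s e)) (enum A)) =
  late_prob m #|A|.
Proof.
by move=> mN; rewrite Pr_perm_all ?enum_uniq// -cardE card_late.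
Qed.

Lemma Pr_isolated m v : (m <= N)%N -> Pr R (fun s => isolated m s v) = late_prob m n.-1.
Proof. by move=> mN; rewrite Pr_late// card_star1. Qed.

Lemma Pr_isolated2 m u v : (m <= N)%N -> u != v ->
  Pr R (fun s => isolated m s u && isolated m s v) = late_prob m (n.-1 + n.-1 - 1).
Proof.
move=> mN uv; rewrite -(card_star2 uv) -Pr_late//; apply: eq_Ex => s.
congr ((_ : bool)%:R); apply/andP/allP => [[/allP H1 /allP H2] e|H].
  rewrite mem_enum !inE => /orP[] ve; [apply: H1|apply: H2]; by rewrite mem_enum inE.
by split; apply/allP => e; rewrite mem_enum => ve; apply: H; rewrite mem_enum inE ve ?orbT.
Qed.

Lemma late_prob_le m a : (m <= N)%N -> (a <= N)%N ->
  late_prob m a <= ((N - m)%:R / N%:R) ^+ a.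
Proof.
move=> mN aN; rewrite -[X in _ ^+ X]card_ord -prodr_const; apply: ler_prod => i _.
rewrite divr_ge0 ?ler0n//= ratio_le ?leq_subr//.
exact: leq_trans (ltn_ord i) aN.
Qed.

(** The factors decrease with [i], so each is at least the one at [i = b]. *)
Lemma late_prob_ge m a b : (m + b <= N)%N -> (a <= b)%N -> (b < N)%N ->
  ((N - m - b)%:R / (N - b)%:R) ^+ a <= late_prob m a.
Proof.
move=> mN ab bN; rewrite -[X in _ ^+ X]card_ord -prodr_const; apply: ler_prod => i _.
rewrite divr_ge0 ?ler0n//=.
have ib : (i < b)%N := leq_trans (ltn_ord i) ab.
have -> : (N - m - b = N - m - i - (b - i))%N by lia.
have -> : (N - b = N - i - (b - i))%N by lia.
by apply: ratio_le; lia.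
Qed.

(* This is P(u, v isolated) / P(u isolated)^2, for the second moment method. *)
Lemma late_prob_pair m a : (m + a < N)%N -> (0 < a)%N ->
  late_prob m (a + a - 1) <= late_prob m a ^+ 2 *
     ((N - a + 1)%:R / (N - m - a + 1)%:R).
Proof.
case: a => // a mN _; rewrite (_ : a.+1 + a.+1 - 1 = a.+1 + a)%N; last by lia.
(* The product of [a.+1 + a] factors is compared with [late_prob m a.+1] times [late_prob m a];
   dividing out one factor then turns this into a square. *)
have gS : late_prob m a = late_prob m a.+1 * ((N - a)%:R / (N - m - a)%:R).
  rewrite /late_prob big_ord_recr /=; field.
  by rewrite !pnatr_eq0; apply/andP; split; lia.
have -> : (N - a.+1 + 1 = N - a)%N by lia.
have -> : (N - m - a.+1 + 1 = N - m - a)%N by lia.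
rewrite expr2 -mulrA -gS {1}/late_prob big_split_ord /= ler_wpM2l//.
  by apply: prodr_ge0 => i _; rewrite divr_ge0 ?ler0n.
apply: ler_prod => i _; rewrite divr_ge0 ?ler0n//=.
have -> : (N - m - (a.+1 + i) = N - m - i - a.+1)%N by lia.
have -> : (N - (a.+1 + i) = N - i - a.+1)%N by lia.
have [ai|ai] := ltnP a.+1 (N - i); first by apply: ratio_le => //; lia.
by rewrite (_ : N - m - i - a.+1 = 0)%N ?mul0r ?divr_ge0 ?ler0n//; lia.
Qed.

Lemma Pr_fst (A : pred {perm edge n}) : Pr R (fun w : Om => A w.1) = Pr R A.
Proof.
rewrite /Pr Ex_pair; apply: eq_Ex => s /=.
by rewrite Ex_cst// card_ffun card_bool expn_gt0.
Qed.

Lemma Pr_not_covered m : (m <= N)%N -> (n.-1 <= N)%N ->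
  Pr R (fun w : Om => ~~ mindeg_ge1 (Eproc w.1 m)) <= n%:R * ((N - m)%:R / N%:R) ^+ n.-1.
Proof.
move=> mN nN; rewrite (Pr_fst (fun s => ~~ mindeg_ge1 (Eproc s m))).
apply: (@le_trans _ _ (Pr R (fun s => [exists v, isolated m s v]))).
  by apply: Pr_sub => s /mindegN[v vE]; apply/existsP; exists v; apply/isolatedP.
rewrite -[X in X%:R * _]card_ord; apply: Pr_exists => v.
by rewrite Pr_isolated// late_prob_le.
Qed.

(** Chebyshev's inequality for the number [X] of isolated vertices, whose mean is n P. The event
    forces X = 0; in the variance, the diagonal gives n P and the distinct pairs an excess of at
    most (n P)^2 r. *)
Lemma Pr_covered m : (m + n.-1 < N)%N -> (1 < n)%N ->
  Pr R (fun w : Om => mindeg_ge1 (Eproc w.1 m)) <=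
  1 / (n%:R * late_prob m n.-1) + m%:R / (N - m - n.-1 + 1)%:R.
Proof.
move=> mN n1; rewrite (Pr_fst (fun s => mindeg_ge1 (Eproc s m))).
have mN' : (m <= N)%N by lia.
set P := late_prob m n.-1; set r := m%:R / _.
have P0 : 0 < P.
  by apply: prodr_gt0 => i _; rewrite divr_gt0 ?ltr0n//; have := ltn_ord i; lia.
have r0 : 0 <= r by rewrite divr_ge0 ?ler0n.
have n0 : 0 < n%:R :> R by rewrite ltr0n; lia.
pose X (s : {perm edge n}) : R := \sum_v (isolated m s v)%:R.
have EX : Ex X = n%:R * P.
  rewrite Ex_sum (eq_bigr (fun=> P)); last by move=> v _; apply: Pr_isolated.
  by rewrite sumr_const card_ord mulr_natl.
have EX2 : Ex (fun s => X s ^+ 2) <= n%:R * P + n%:R ^+ 2 * (P ^+ 2 * (1 + r)).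
  rewrite (eq_Ex (g := fun s => \sum_u \sum_v (isolated m s u && isolated m s v)%:R)); last first.
    move=> s; rewrite expr2 mulr_suml; apply: eq_bigr => u _.
    by rewrite mulr_sumr; apply: eq_bigr => v _; rewrite -natrM mulnb.
  rewrite Ex_sum.
  apply: (@le_trans _ _ (\sum_(u : 'I_n) (P + n%:R * (P ^+ 2 * (1 + r))))); last first.
    by rewrite sumr_const card_ord -[leLHS]mulr_natl mulrDr expr2 mulrA.
  apply: ler_sum => u _; rewrite Ex_sum (bigD1 u)//=.
  apply: lerD.
    rewrite /P -(Pr_isolated u mN') /Pr le_eqVlt; apply/orP; left; apply/eqP.
    by apply: eq_Ex => s; rewrite andbb.
  apply: (@le_trans _ _ (\sum_(v : 'I_n | v != u) (P ^+ 2 * (1 + r)))).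
    apply: ler_sum => v vu; rewrite -[leLHS]/(Pr R _) Pr_isolated2//; last by rewrite eq_sym.
    apply: le_trans (late_prob_pair mN _) _; first by lia.
    rewrite ler_wpM2l ?(exprn_ge0 _ (ltW P0))// /r.
    have d0 : (N - m - n.-1 + 1)%:R != 0 :> R by rewrite pnatr_eq0; lia.
    rewrite -[X in X + _](divff d0) -mulrDl le_eqVlt; apply/orP; left; apply/eqP.
    by congr (_ / _); rewrite -natrD; congr (_%:R); lia.
  rewrite sumr_const -[leLHS]mulr_natl; apply: ler_wpM2r.
    by rewrite mulr_ge0 ?(exprn_ge0 _ (ltW P0))// addr_ge0.
  by rewrite ler_nat -[leqRHS](card_ord n); exact: max_card.
have H : (n%:R * P) ^+ 2 * Pr R (fun s : {perm edge n} => mindeg_ge1 (Eproc s m)) <=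
    Ex (fun s => (X s - n%:R * P) ^+ 2).
  rewrite /Pr -ExZ; apply: Ex_le => s; case: (boolP (mindeg_ge1 _)) => [md|_]; last first.
    by rewrite mulr0 sqr_ge0.
  rewrite mulr1 /X big1 ?sub0r ?sqrrN// => v _.
  case: isolatedP => // H; move/forallP/(_ v)/existsP: md => [e /andP[eE ve]].
  by have := H e ve; rewrite eE.
have E2 : Ex (fun s => (X s - n%:R * P) ^+ 2) = Ex (fun s => X s ^+ 2) - (n%:R * P) ^+ 2.
  rewrite (eq_Ex (g := fun s => X s ^+ 2 + (- 2 * (n%:R * P) * X s + (n%:R * P) ^+ 2))); last first.
    by move=> s; ring.
  rewrite !ExD ExZ EX Ex_cst ?card_perm_gt0//; ring.
have nP0 : 0 < n%:R * P by rewrite mulr_gt0.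
rewrite E2 in H.
have H2 : (n%:R * P) ^+ 2 * Pr R (fun s : {perm edge n} => mindeg_ge1 (Eproc s m)) <= n%:R * P + (n%:R * P) ^+ 2 * r.
  apply: le_trans H _; rewrite lerBlDr; apply: le_trans EX2 _.
  by rewrite exprMn le_eqVlt; apply/orP; left; apply/eqP; ring.
rewrite -(ler_pM2l (exprn_gt0 2 nP0)); apply: le_trans H2 _.
rewrite mulrDr lerD2r le_eqVlt; apply/orP; left; apply/eqP; field.
by rewrite !gt_eqF.
Qed.

End IsolatedVertices.

(** * Union bounds over the exceptional configurations *)

Section Structures.
Variables (R : realType) (n : nat).
Local Notation N := (Nedges n).
Local Notation Om := ({perm edge n} * {ffun edge n -> bool})%type.
Implicit Types (w : Om).
Variables (m0 m1 K : nat).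
Hypotheses (m1N : (m1 <= N)%N) (m0N : (m0 <= N)%N) (m03 : (3 < m0)%N) (m01 : (m0 <= m1)%N).

Local Notation p := (m1%:R / N%:R : R).

(** The bound of [Pr_deficient] for three pairs, at its worst over at most three edges and four
    vertices, so that it serves all three structures below. *)
Definition poor_bound : R := expR 3 ^+ (3 * K) *
  expR (- ((m0 - 3)%:R / N%:R / 2 * (1 - expR (- 3)) * (3 * (n - 4))%:R)).

Lemma poor_bound_ge0 : 0 <= poor_bound.
Proof. by rewrite mulr_ge0 ?exprn_ge0 ?expR_ge0. Qed.

(* The union bound over a connected structure with k <= 3 edges, hence k + 1
   vertices, and three deficient (vertex, colour) pairs gains about
   n (n p)^k n^(-1.07), where n p is of order l. *)
Lemma Pr_structure (ts : seq 'I_n) (es : seq ('I_n * 'I_n)) (ps : seq ('I_n * bool)) :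
    (size ts <= 4)%N -> (size es <= 3)%N -> uniq ps -> size ps = 3 ->
    all (fun uv => [&& uv.1 != uv.2, uv.1 \in ts & uv.2 \in ts]) es ->
    uniq [seq [set uv.1; uv.2] | uv <- es] -> all (fun vc => vc.1 \in ts) ps ->
  Pr R (fun w => all (fun uv => adj (Eproc w.1 m1) uv.1 uv.2) es &&
                 all (fun vc => edeg (Eproc w.1 m0) w.2 vc.1 vc.2 <= K)%N ps) <=
  p ^+ size es * poor_bound.
Proof.
move=> ts4 es3 ups ps3 /allP eT ues /allP pT.
pose B := [set e : edge n | val e \in [seq [set uv.1; uv.2] | uv <- es]].
pose T := [set v | v \in ts]; pose P := [set vc | vc \in ps].
have cB : #|B| = size es.
  rewrite -(card_imset _ val_inj) -(size_map (fun uv => [set uv.1; uv.2])) -(card_uniqP ues).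
  apply: eq_card => A; apply/imsetP/idP => [[e + ->]|/mapP[uv uve ->]]; first by rewrite inE.
  have /and3P[/mk_edge[e ee] _ _] := eT _ uve; exists e => //.
  by rewrite inE ee; apply/mapP; exists uv.
have cP : #|P| = 3 by rewrite cardsE (card_uniqP ups).
have cT : (#|T| <= 4)%N by rewrite cardsE; apply: leq_trans (card_size _) ts4.
have Bm0 : (#|B| <= m0)%N by rewrite cB; lia.
have BN : (#|B| < N)%N by rewrite cB; lia.
have BT e : e \in B -> val e \subset T.
  rewrite inE => /mapP[uv /eT/and3P[_ u1 u2] ->].
  by apply/subsetP => z; rewrite !inE => /orP[]/eqP->.
have PT vc : vc \in P -> vc.1 \in T by rewrite !inE => /pT.
apply: le_trans (le_trans (Pr_deficient R K m1N m0N Bm0 BN BT PT) _).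
  apply: Pr_sub => w /andP[/allP es_w /allP ps_w]; apply/andP; split.
    apply/subsetP => e; rewrite inE => /mapP[uv /es_w/existsP[f /andP[fE /eqP fe]] ee].
    by rewrite (_ : e = f)//; apply: val_inj; rewrite fe.
  by apply/forallP => vc; apply/implyP; rewrite inE => /ps_w.
rewrite cB cP mulrCA ler_wpM2l ?exprn_ge0 ?divr_ge0 ?ler0n// /poor_bound.
rewrite ler_wpM2l ?exprn_ge0 ?expR_ge0// ler_expR lerN2.
have l1 : (expR (- 3) : R) <= 1 by rewrite expR_le1; lra.
apply: ler_pM.
- by rewrite !mulr_ge0 ?invr_ge0 ?ler0n// subr_ge0.
- exact: ler0n.
- rewrite ler_wpM2r ?subr_ge0// ler_wpM2r ?invr_ge0 ?ler0n//.
  apply: ler_pM; rewrite ?ler0n ?invr_ge0 ?ler0n ?ler_nat//; first by lia.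
  by rewrite lef_pV2 ?posrE ?ltr0n ?ler_nat; lia.
- by rewrite ler_nat leq_mul2l leq_sub2l.
Qed.

Lemma adj_Eproc_le (s : {perm edge n}) a b u v : (a <= b)%N -> adj (Eproc s a) u v -> adj (Eproc s b) u v.
Proof.
move=> ab /existsP[e /andP[+ ee]]; rewrite inE => ea; apply/existsP; exists e.
by rewrite ee andbT inE (leq_trans ea ab).
Qed.

Lemma not_rich (D : {set edge n}) (c : {ffun edge n -> bool}) v : ~~ rich D c K v -> exists col, (edeg D c v col <= K)%N.
Proof. by rewrite negb_forall => /existsP[col]; rewrite -leqNgt; exists col. Qed.

Lemma Pr_exists_card (I : finType) (A : I -> pred Om) (b : R) (k : nat) : 0 <= b -> (#|I| <= k)%N ->
  (forall i, Pr R (A i) <= b) -> Pr R (fun w => [exists i, A i w]) <= k%:R * b.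
Proof.
move=> b0 Ik Ab; apply: le_trans (Pr_exists Ab) _.
by rewrite ler_wpM2r// ler_nat.
Qed.

Lemma Pr_never (A : pred Om) (b : R) : 0 <= b -> (forall w, ~~ A w) -> Pr R A <= b.
Proof.
move=> b0 A0; rewrite /Pr (eq_Ex (g := fun=> 0)); last by move=> w; rewrite (negbTE (A0 w)).
by rewrite /Ex big1 ?mul0r.
Qed.

Lemma pb_ge0 i : 0 <= p ^+ i * poor_bound.
Proof. by rewrite mulr_ge0 ?exprn_ge0 ?divr_ge0 ?ler0n// poor_bound_ge0. Qed.

(** The structure is a star with three leaves, each deficient in some colour: four vertices and
    three colours to choose. *)
Lemma Pr_many_poor : Pr R (fun w => [exists v, 2 < #|poor_edges (Eproc w.1 m0) w.2 K v|]%N) <=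
  (8 * n ^ 4)%:R * (p ^+ 3 * poor_bound).
Proof.
pose A (i : 'I_n * 'I_n * 'I_n * 'I_n * (bool * bool * bool)) : pred Om :=
  fun w => let: (x, a, b, d, (ca, cb, cd)) := i in
  uniq [:: x; a; b; d] &&
  (all (fun uv => adj (Eproc w.1 m1) uv.1 uv.2) [:: (x, a); (x, b); (x, d)] &&
   all (fun vc => edeg (Eproc w.1 m0) w.2 vc.1 vc.2 <= K)%N [:: (a, ca); (b, cb); (d, cd)]).
apply: (@le_trans _ _ (Pr R (fun w => [exists i, A i w]))); last first.
  apply: Pr_exists_card; first exact: pb_ge0.
    by rewrite !card_prod !card_ord card_bool; lia.
  move=> [[[[x a] b] d] [[ca cb] cd]].
  have [u|nu] := boolP (uniq [:: x; a; b; d]); last first.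
    by apply: Pr_never; [exact: pb_ge0|move=> w; rewrite /A (negbTE nu)].
  apply: le_trans (_ : _ <= Pr R (fun w =>
    all (fun uv => adj (Eproc w.1 m1) uv.1 uv.2) [:: (x, a); (x, b); (x, d)] &&
    all (fun vc => edeg (Eproc w.1 m0) w.2 vc.1 vc.2 <= K)%N [:: (a, ca); (b, cb); (d, cd)])) _.
    by apply: Pr_sub => w /andP[].
  move: u; rewrite /= !inE !negb_or !andbT => /and3P[/and3P[xa xb xd] /andP[ab ad] bd].
  apply: (@Pr_structure [:: x; a; b; d] [:: (x, a); (x, b); (x, d)] [:: (a, ca); (b, cb); (d, cd)]) => //=.
  - by rewrite !inE /= -!pair_eqE /= !negb_or !negb_and ab ad bd.
  - by rewrite !inE !eqxx ?orbT xa xb xd.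
  - rewrite !inE !negb_or andbT -andbA.
    by apply/and3P; split; [move: ab|move: ad|move: bd]; apply: contraNneq => /set2_inj->.
  - by rewrite !inE !eqxx ?orbT.
apply: Pr_sub => w /existsP[x /card_gt2P[e1 [e2 [e3 [[E1 E2 E3] [n12 n23 n31]]]]]].
have H e : e \in poor_edges (Eproc w.1 m0) w.2 K x -> exists a col,
    [/\ val e = [set x; a], adj (Eproc w.1 m1) x a & (edeg (Eproc w.1 m0) w.2 a col <= K)%N].
  rewrite inE => /and3P[eD xe /existsP[a /and3P[ae ax /not_rich[col ac]]]].
  have [b bx ee] := edgeP xe; move: ae ax; rewrite ee !inE => /orP[->//|/eqP ab ax].
  subst a; exists b, col; split => //; apply: (adj_Eproc_le m01); exact: adjE ee.
have [a [ca [ea xa da]]] := H _ E1; have [b [cb [eb xb db]]] := H _ E2.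
have [d [cd [ed xd dd]]] := H _ E3.
apply/existsP; exists (x, a, b, d, (ca, cb, cd)); rewrite /= xa xb xd da db dd !andbT.
rewrite !inE !negb_or (edge_neq ea) (edge_neq eb) (edge_neq ed) /=.
rewrite ?andbT -andbA; apply/and3P; split.
- by apply: contraNneq n12 => ab; apply/eqP/val_inj; rewrite ea eb ab.
- by apply: contraNneq n31 => ab; apply/eqP/val_inj; rewrite ea ed ab.
- by apply: contraNneq n23 => ab; apply/eqP/val_inj; rewrite eb ed ab.
Qed.

(** A poor vertex supplies two deficient pairs, one per colour, and its neighbour that is not rich
    supplies the third. This is why [poor] asks for both colours. *)
Lemma Pr_poor_edge : Pr R (fun w => [exists i : 'I_n * 'I_n, [&& adj (Eproc w.1 m1) i.1 i.2,
    poor (Eproc w.1 m0) w.2 K i.1 & ~~ rich (Eproc w.1 m0) w.2 K i.2]]) <=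
  (2 * n ^ 2)%:R * (p * poor_bound).
Proof.
pose A (i : 'I_n * 'I_n * bool) : pred Om := fun w => let: (x, a, ca) := i in
  (x != a) && (all (fun uv => adj (Eproc w.1 m1) uv.1 uv.2) [:: (x, a)] &&
   all (fun vc => edeg (Eproc w.1 m0) w.2 vc.1 vc.2 <= K)%N [:: (x, true); (x, false); (a, ca)]).
rewrite -[X in X * poor_bound]expr1.
apply: (@le_trans _ _ (Pr R (fun w => [exists i, A i w]))); last first.
  apply: Pr_exists_card; first exact: pb_ge0.
    by rewrite !card_prod !card_ord card_bool; lia.
  move=> [[x a] ca].
  have [u|nu] := boolP (x != a); last first.
    by apply: Pr_never; [exact: pb_ge0|move=> w; rewrite /A (negbTE nu)].
  apply: le_trans (_ : _ <= Pr R (fun w =>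
    all (fun uv => adj (Eproc w.1 m1) uv.1 uv.2) [:: (x, a)] &&
    all (fun vc => edeg (Eproc w.1 m0) w.2 vc.1 vc.2 <= K)%N [:: (x, true); (x, false); (a, ca)])) _.
    by apply: Pr_sub => w /andP[].
  apply: (@Pr_structure [:: x; a] [:: (x, a)] [:: (x, true); (x, false); (a, ca)]) => //=.
  - by rewrite !inE /= -!pair_eqE /= !negb_or !negb_and u eqxx.
  - by rewrite !inE !eqxx ?orbT u.
  - by rewrite !inE !eqxx ?orbT.
apply: Pr_sub => w /existsP[[x a] /= /and3P[xa /forallP px /not_rich[col ac]]].
apply/existsP; exists (x, a, col); rewrite /= xa ac !px !andbT.
by move: xa => /existsP[e /andP[_ /eqP ee]]; exact: edge_neq ee.
Qed.

Lemma Pr_poor_cherry : Pr R (fun w => [exists i : 'I_n * 'I_n * 'I_n,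
   [&& i.1.1 != i.2, adj (Eproc w.1 m1) i.1.1 i.1.2, adj (Eproc w.1 m1) i.1.2 i.2,
    poor (Eproc w.1 m0) w.2 K i.1.1 & ~~ rich (Eproc w.1 m0) w.2 K i.2]]) <=
  (2 * n ^ 3)%:R * (p ^+ 2 * poor_bound).
Proof.
pose A (i : 'I_n * 'I_n * 'I_n * bool) : pred Om := fun w => let: (x, a, y, cy) := i in
  uniq [:: x; a; y] && (all (fun uv => adj (Eproc w.1 m1) uv.1 uv.2) [:: (x, a); (a, y)] &&
   all (fun vc => edeg (Eproc w.1 m0) w.2 vc.1 vc.2 <= K)%N [:: (x, true); (x, false); (y, cy)]).
apply: (@le_trans _ _ (Pr R (fun w => [exists i, A i w]))); last first.
  apply: Pr_exists_card; first exact: pb_ge0.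
    by rewrite !card_prod !card_ord card_bool; lia.
  move=> [[[x a] y] cy].
  have [u|nu] := boolP (uniq [:: x; a; y]); last first.
    by apply: Pr_never; [exact: pb_ge0|move=> w; rewrite /A (negbTE nu)].
  apply: le_trans (_ : _ <= Pr R (fun w =>
    all (fun uv => adj (Eproc w.1 m1) uv.1 uv.2) [:: (x, a); (a, y)] &&
    all (fun vc => edeg (Eproc w.1 m0) w.2 vc.1 vc.2 <= K)%N [:: (x, true); (x, false); (y, cy)])) _.
    by apply: Pr_sub => w /andP[].
  move: u; rewrite /= !inE !negb_or !andbT => /andP[/andP[xa xy] ay].
  apply: (@Pr_structure [:: x; a; y] [:: (x, a); (a, y)] [:: (x, true); (x, false); (y, cy)]) => //=.
  - by rewrite !inE /= -!pair_eqE /= !negb_or !negb_and xy eqxx.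
  - by rewrite !inE !eqxx ?orbT xa ay.
  - by rewrite !inE andbT; apply: contraNneq xy => H; rewrite setUC in H; rewrite (set2_inj H).
  - by rewrite !inE !eqxx ?orbT.
apply: Pr_sub => w /existsP[[[x a] y] /= /and5P[xy xa ay /forallP px /not_rich[col yc]]].
apply/existsP; exists (x, a, y, col); rewrite /= xa ay yc !px !andbT.
move: xa ay => /existsP[e /andP[_ /eqP ee]] /existsP[f /andP[_ /eqP fe]].
by rewrite !inE negb_or xy (edge_neq ee) (edge_neq fe).
Qed.

(** A union bound over the sizes [u], then over the sets of size [u], each controlled by
    [Pr_dense]. *)
Lemma Pr_dense_set (t u0 : nat) (lam b : R) : 1 <= lam ->
    (forall u, (0 < u <= u0)%N ->
       ('C(n, u))%:R * (lam ^- (t * u) * expR (lam * (m0%:R / N%:R) * ('C(u, 2))%:R)) <= b) ->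
    0 <= b ->
  Pr R (fun w => [exists U : {set 'I_n}, (0 < #|U| <= u0)%N &&
     (t * #|U| <= #|Eproc w.1 m0 :&: [set e : edge n | val e \subset U]|)%N]) <=
  u0.+1%:R * b.
Proof.
move=> lam1 H b0.
pose A (u : 'I_u0.+1) : pred Om := fun w => (0 < u)%N &&
  [exists U : {set 'I_n}, (#|U| == u) &&
     (t * u <= #|Eproc w.1 m0 :&: [set e : edge n | val e \subset U]|)%N].
apply: (@le_trans _ _ (Pr R (fun w => [exists u, A u w]))).
  apply: Pr_sub => w /existsP[U /andP[/andP[U0 Uu] dU]].
  apply/existsP; exists (Ordinal (Uu : (#|U| < u0.+1)%N)); rewrite /A U0 /=.
  by apply/existsP; exists U; rewrite eqxx.
apply: Pr_exists_card => //; first by rewrite card_ord.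
move=> [u uu]; have [u_0|u_gt0] := posnP u.
  by apply: Pr_never => // w; rewrite /A /= u_0.
apply: le_trans (H u _); last by rewrite u_gt0.
apply: (@le_trans _ _ (Pr R (fun w => [exists U : {U : {set 'I_n} | #|U| == u},
     (t * u <= #|Eproc w.1 m0 :&: [set e : edge n | val e \subset val U]|)%N]))).
  apply: Pr_sub => w /andP[_ /existsP[U /andP[/= Uu dU]]].
  by apply/existsP; exists (exist (fun U : {set 'I_n} => #|U| == u) U Uu).
apply: Pr_exists_card.
- by rewrite mulr_ge0 ?invr_ge0 ?exprn_ge0 ?expR_ge0//; lra.
- rewrite card_sig -[n in 'C(n, _)]card_ord -card_draws.
  by apply/eq_leq/eq_card => U; rewrite !inE.
- move=> [U /= /eqP Uu]; rewrite -Uu -card_inside.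
  exact: Pr_dense.
Qed.

Lemma Pr_not_joined (s0 : nat) : Pr R (fun w => [exists i : {set 'I_n} * {set 'I_n} * bool,
    [&& [disjoint i.1.1 & i.1.2], s0 <= #|i.1.1|, s0 <= #|i.1.2| &
     ~~ [exists e in Eproc w.1 m0, (w.2 e == i.2) &&
       [exists a in i.1.1, [exists b in i.1.2, val e == [set a; b]]]]]%N]) <=
  (2 ^ n * 2 ^ n * 2)%:R * expR (- (m0%:R / N%:R / 2 * (s0 ^ 2)%:R)).
Proof.
apply: Pr_exists_card; first exact: expR_ge0.
  by rewrite !card_prod card_bool -cardsT -powersetT card_powerset cardsT card_ord.
move=> [[S S'] col] /=.
have [/and3P[dis sS sS']|nS] := boolP [&& [disjoint S & S'], s0 <= #|S| & s0 <= #|S'|]%N; last first.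
  by apply: Pr_never => [|w]; [exact: expR_ge0|apply: contraNN nS => /and4P[-> -> ->]].
pose btw (e : edge n) := [exists a in S, [exists b in S', val e == [set a; b]]].
(* With this 0-1 weight the product in [Ex_weight], taken with empty [B], is the indicator that no
   edge of colour [col] joins [S] and [S'] at time [m0]. *)
pose h (e : edge n) (c : bool) : R := ((c == col) && btw e)%:R.
have h01 e c : 0 <= h e c <= 1 by rewrite /h ler0n /= lern1; case: (_ && _).
have N0 : (#|@set0 (edge n)| < N)%N by rewrite cards0; lia.
have M0 : (#|@set0 (edge n)| <= m0)%N by rewrite cards0.
have hB e c : e \in set0 -> h e c = 0 by rewrite inE.
have := Ex_weight m1N m0N M0 N0 h01 hB.
rewrite cards0 expr0 mul1r !subn0 => H.
apply: (@le_trans _ _ (Ex (fun w : Om => (set0 \subset Eproc w.1 m1)%:R *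
          \prod_e (1 - h e (w.2 e) * (e \in Eproc w.1 m0)%:R)))).
  apply: Pr_Ex => w.
    rewrite mulr_ge0 ?ler0n// prodr_ge0// => e _.
    by rewrite /h -natrM subr_ge0 lern1; case: (_ && _); case: (_ \in _).
  move=> /and4P[_ _ _ /existsPn nE]; rewrite sub0set mul1r big1// => e _.
  have := nE e; rewrite /h /btw; case: (e \in _); last by rewrite mulr0 subr0.
  by rewrite /= => /negbTE ->; rewrite mul0r subr0.
apply: le_trans H _; rewrite ler_expR lerN2 ler_wpM2l//.
  by rewrite !mulr_ge0 ?invr_ge0 ?ler0n.
rewrite (eq_bigr (fun e => (btw e)%:R)); last first.
  move=> e _; rewrite /h -natrD; congr (_%:R).
  by case: (col); case: (btw e).
rewrite -natr_sum ler_nat; apply: (@leq_trans (#|S| * #|S'|)).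
  by rewrite expnS expn1 leq_mul.
apply: leq_trans (card_between dis) _.
rewrite -sum1_card big_mkcond; apply: leq_sum => e _.
by rewrite inE -/(btw e); case: (btw e).
Qed.

End Structures.

(** * Locating the hitting time *)

Section HittingTime.
Variables (n : nat) (s : {perm edge n}).
Local Notation N := (Nedges n).

Lemma Eproc_subset a b : (a <= b)%N -> Eproc s a \subset Eproc s b.
Proof. by move=> ab; apply/subsetP => e; rewrite !inE => ea; exact: leq_trans ea ab. Qed.

Lemma mindeg_subset (E E' : {set edge n}) : E \subset E' -> mindeg_ge1 E -> mindeg_ge1 E'.
Proof.
move=> EE /forallP H; apply/forallP => v; have /existsP[e /andP[eE ve]] := H v.
by apply/existsP; exists e; rewrite (subsetP EE).
Qed.

(** Since [m1 <= N], the search defining [tau1] succeeds and does not return its default value;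
    monotonicity of the process gives the lower end. *)
Lemma tau1_window m0 m1 : (m1 <= N)%N -> mindeg_ge1 (Eproc s m1) ->
    ~~ mindeg_ge1 (Eproc s m0) ->
  [/\ mindeg_ge1 (Eproc s (tau1 s)), (m0 <= tau1 s)%N & (tau1 s <= m1)%N].
Proof.
move=> m1N d1 d0; pose P m := mindeg_ge1 (Eproc s m).
have hP : has P (iota 0 N.+1) by apply/hasP; exists m1; rewrite // mem_iota.
have tN : (tau1 s < N.+1)%N by move: hP; rewrite has_find size_iota.
have dt : P (tau1 s) by have := nth_find 0%N hP; rewrite nth_iota.
split => //.
  by rewrite leqNgt; apply: contraNN d0 => /ltnW/Eproc_subset/mindeg_subset; apply.
rewrite leqNgt; apply/negP => /(before_find 0%N); rewrite nth_iota ?add0n//.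
by rewrite d1.
Qed.

End HittingTime.

(** * Typical outcomes and the total failure probability *)

Section Failure.
Variables (R : realType) (n : nat).
Local Notation N := (Nedges n).
Local Notation Om := ({perm edge n} * {ffun edge n -> bool})%type.
Variables (m0 m1 t u0 s0 : nat).
Hypotheses (m1N : (m1 <= N)%N) (m01 : (m0 <= m1)%N) (m03 : (3 < m0)%N) (n1 : (1 < n)%N).
Hypotheses (m0n : (m0 + n.-1 < N)%N).
Hypotheses (t0 : (0 < t)%N) (s00 : (0 < s0)%N) (su0 : (16 * s0 <= u0)%N).
Local Notation K := (16 * t + 2)%N.
Local Notation p := (m1%:R / N%:R : R).

Definition typical (w : Om) : bool :=
  [&& ~~ [exists v, 2 < #|poor_edges (Eproc w.1 m0) w.2 K v|]%N,
      ~~ [exists i : 'I_n * 'I_n, [&& adj (Eproc w.1 m1) i.1 i.2,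
            poor (Eproc w.1 m0) w.2 K i.1 & ~~ rich (Eproc w.1 m0) w.2 K i.2]],
      ~~ [exists i : 'I_n * 'I_n * 'I_n,
            [&& i.1.1 != i.2, adj (Eproc w.1 m1) i.1.1 i.1.2, adj (Eproc w.1 m1) i.1.2 i.2,
                poor (Eproc w.1 m0) w.2 K i.1.1 & ~~ rich (Eproc w.1 m0) w.2 K i.2]],
      ~~ [exists U : {set 'I_n}, (0 < #|U| <= u0)%N &&
            (t * #|U| <= #|Eproc w.1 m0 :&: [set e : edge n | val e \subset U]|)%N],
      ~~ [exists i : {set 'I_n} * {set 'I_n} * bool,
            [&& [disjoint i.1.1 & i.1.2], s0 <= #|i.1.1|, s0 <= #|i.1.2| &
             ~~ [exists e in Eproc w.1 m0, (w.2 e == i.2) &&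
               [exists a in i.1.1, [exists b in i.1.2, val e == [set a; b]]]]]%N],
      mindeg_ge1 (Eproc w.1 m1) & ~~ mindeg_ge1 (Eproc w.1 m0)].

(** The conditions on neighbours of poor vertices are imposed at the fixed time [m1]. They pass to
    the random time [tau1], as the graph there is contained in the one at [m1]. *)
Lemma typical_zebraic w : typical w -> all_pairs_zebraic w.1 w.2.
Proof.
move=> /and5P[/existsPn few /existsPn edg /existsPn cherry /existsPn sparse].
move=> /and3P[/existsPn joined d1 d0] x y xy.
have [dt m0t tm1] := tau1_window m1N d1 d0.
have adj1 (e : edge n) u v : e \in Eproc w.1 (tau1 w.1) -> val e = [set u; v] ->
    adj (Eproc w.1 m1) u v.
  by move=> eG ee; apply: adjE ee; exact: (subsetP (Eproc_subset _ tm1)).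
apply: (@zebraic_connected n (Eproc w.1 m0) _ _ t u0 s0) => //.
- exact: Eproc_subset.
- by move=> v; rewrite leqNgt; exact: few.
- move=> e u v eG ee pu; have := edg (u, v).
  by rewrite /= (adj1 e)// pu /= negbK.
- move=> e f u v z eG fG ee fe uz pu; have := cherry (u, v, z).
  by rewrite /= uz (adj1 e)// (adj1 f)// pu /= negbK.
- by move=> U Uu; have := sparse U; rewrite Uu /= -ltnNge.
- move=> S S' col dis sS sS'; have := joined (S, S', col).
  rewrite /= dis sS sS' /= negbK => /existsP[e /and3P[eD /eqP ce]].
  move=> /existsP[a /andP[aS /existsP[b /andP[bS /eqP ee]]]].
  by exists e, a, b.
Qed.

Lemma Pr_atypical (lam b : R) : 1 <= lam -> 0 <= b ->
    (forall u, (0 < u <= u0)%N ->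
       ('C(n, u))%:R * (lam ^- (t * u) * expR (lam * (m0%:R / N%:R) * ('C(u, 2))%:R)) <= b) ->
  Pr R (fun w : Om => ~~ typical w) <=
    (8 * n ^ 4)%:R * (p ^+ 3 * poor_bound R n m0 K) +
    (2 * n ^ 2)%:R * (p * poor_bound R n m0 K) +
    (2 * n ^ 3)%:R * (p ^+ 2 * poor_bound R n m0 K) +
    u0.+1%:R * b +
    (2 ^ n * 2 ^ n * 2)%:R * expR (- (m0%:R / N%:R / 2 * (s0 ^ 2)%:R)) +
    n%:R * ((N - m1)%:R / N%:R) ^+ n.-1 +
    (1 / (n%:R * late_prob R n m0 n.-1) + m0%:R / (N - m0 - n.-1 + 1)%:R).
Proof.
move=> lam1 b0 Hb; have m0N : (m0 <= N)%N by lia.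
have nN : (n.-1 <= N)%N by lia.
have H1 := Pr_many_poor R K m1N m0N m03 m01.
have H2 := Pr_poor_edge R K m1N m0N m03 m01.
have H3 := Pr_poor_cherry R K m1N m0N m03 m01.
have H4 := Pr_dense_set m0N lam1 Hb b0.
have H5 := Pr_not_joined R m1N m0N m03 m01 s0.
have H6 := Pr_not_covered R m1N nN.
have H7 := Pr_covered R m0n n1.
have or_le (A B : pred Om) (x y : R) : Pr R A <= x -> Pr R B <= y ->
    Pr R (fun w => A w || B w) <= x + y.
  by move=> Ax By; apply: le_trans (Pr_or _ _ _) (lerD Ax By).
apply: le_trans (or_le _ _ _ _ (or_le _ _ _ _ (or_le _ _ _ _ (or_le _ _ _ _
  (or_le _ _ _ _ (or_le _ _ _ _ H1 H2) H3) H4) H5) H6) H7).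
by apply: Pr_sub => w; rewrite /typical !negb_and !negbK !orbA.
Qed.

End Failure.

(** * Choice of the parameters and asymptotic estimates *)

Section Asymptotics.
Variables (R : realType) (n : nat).
Local Notation N := (Nedges n).
Local Notation x := (n%:R : R).
Local Notation l := (ln (n%:R : R)).
Variable lam : R.
Hypothesis lamE : lam = expR (5 * 1000).
Hypotheses (n_gt0 : (0 < n)%N) (l_large : 100 * 1000 <= l) (lam_small : 4000 * lam ^+ 2 <= l).

Lemma natr_gt0 : 0 < x. Proof. by rewrite ltr0n. Qed.

Lemma natr_expR_ln : x = expR l. Proof. by rewrite lnK// posrE natr_gt0. Qed.

Lemma natr_mul_expR (a : R) : x * expR a = expR (l + a).
Proof. by rewrite exp.expRD -natr_expR_ln. Qed.

Lemma pow4_expR (a : R) : 0 <= a -> (a / 4) ^+ 4 <= expR a.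
Proof.
move=> a0; rewrite (_ : expR a = expR (a / 4) ^+ 4); last first.
  by rewrite -expRM_natl; congr expR; field.
have := expR_ge1Dx (a / 4) => h.
by apply: lerXn2r; rewrite ?nnegrE ?expR_ge0 ?divr_ge0//; lra.
Qed.

Lemma expR_le_inv (a : R) : 0 < a -> expR (- a) <= 1 / a.
Proof.
move=> a0; rewrite expRN ler_pdivlMr// mulrC ler_pdivrMr ?expR_gt0// mul1r.
by have := expR_ge1Dx a; lra.
Qed.

(** Apply 1 + z <= exp z with z = y / (1 - y), for which 1 + z = 1 / (1 - y). *)
Lemma expR_frac_le (y : R) : 0 < 1 - y -> expR (- (y / (1 - y))) <= 1 - y.
Proof.
move=> y1; rewrite expRN -[leRHS]invrK lef_pV2 ?posrE ?expR_gt0 ?invr_gt0//.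
apply: le_trans (expR_ge1Dx _); rewrite le_eqVlt; apply/orP; left; apply/eqP.
by field; rewrite gt_eqF.
Qed.

Lemma l_gt0 : 0 < l. Proof. by have := l_large; lra. Qed.

Lemma ln_cube_le : l ^+ 3 <= x.
Proof.
have l0 := l_gt0; have h : (l / 4) ^+ 4 <= x.
  by rewrite [leRHS]natr_expR_ln; exact: pow4_expR (ltW l0).
apply: le_trans h.
have -> : (l / 4) ^+ 4 = l ^+ 3 * (l / 256) by field.
by rewrite ler_peMr ?exprn_ge0 ?(ltW l0)//; have := l_large; lra.
Qed.

Lemma ln_sqr_le : 100 * 1000 * l ^+ 2 <= x.
Proof.
apply: le_trans ln_cube_le; rewrite (exprS l 2) ler_wpM2r// exprn_ge0//.
exact: ltW l_gt0.
Qed.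

Lemma ln_small : 1000 * l <= x.
Proof.
apply: le_trans ln_sqr_le; rewrite expr2.
by have := l_large; have := l_gt0; nra.
Qed.

Lemma natr_large : 1000 * 1000 <= x.
Proof.
by apply: le_trans ln_small; have := l_large; lra.
Qed.

Lemma Nedges_natr : N%:R = x * (x - 1) / 2 :> R.
Proof.
rewrite Nedges_bin bin2; have -> : x - 1 = n.-1%:R.
  by rewrite -subn1 natrB.
have o : odd (n * n.-1) = false.
  by case: (n) => // k; rewrite oddM /=; case: (odd k).
have := odd_double_half (n * n.-1); rewrite o add0n; set k := _./2 => h.
by rewrite -natrM -h -muln2 natrM; field.
Qed.

(** Isolated vertices disappear around n l / 2 steps. [win0] lies slightly below this threshold, and
    [win1] at about twice it. *)
Definition win0 : nat := Num.truncn (19 / 40 * x * l).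
Definition win1 : nat := (Num.truncn (x * l)).+1.
Definition density : nat := Num.truncn (l / 1000).
Definition small_size : nat := Num.truncn (x / lam).
Definition linear_size : nat := (small_size %/ 16)%N.
Local Notation m0 := win0.
Local Notation m1 := win1.
Local Notation t := density.
Local Notation u0 := small_size.
Local Notation s0 := linear_size.
Local Notation K := (16 * t + 2)%N.

Lemma truncn_bounds (a : R) : 0 <= a -> a - 1 <= (Num.truncn a)%:R <= a.
Proof. by move=> /truncn_itv; rewrite -natr1; lra. Qed.

Lemma win0_bounds : 19 / 40 * x * l - 1 <= m0%:R <= 19 / 40 * x * l.
Proof.
have h : 0 <= 19 / 40 * x * l.
  by rewrite !mulr_ge0 ?(ltW l_gt0)//; lra.
exact: truncn_bounds.
Qed.

Lemma win1_bounds : x * l <= m1%:R <= x * l + 1.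
Proof.
have h : 0 <= x * l by rewrite mulr_ge0// ltW// l_gt0.
by have := truncn_bounds h; rewrite /m1 -natr1; lra.
Qed.

Lemma density_bounds : l / 1250 <= t%:R <= l / 1000.
Proof.
have h : 0 <= l / 1000 by rewrite divr_ge0// ltW// l_gt0.
have := truncn_bounds h; rewrite -/t; have := l_large; lra.
Qed.

Lemma lam_ge1 : 1 <= lam.
Proof. by rewrite lamE ltW// expR_gt1; lra. Qed.

Lemma lam_gt0 : 0 < lam.
Proof. exact: lt_le_trans ltr01 lam_ge1. Qed.

Lemma small_size_bounds : x / lam - 1 <= u0%:R <= x / lam.
Proof.
have h : 0 <= x / lam by rewrite divr_ge0// ltW// lam_gt0.
exact: truncn_bounds.
Qed.

Lemma linear_size_ge : x / (20 * lam) <= s0%:R.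
Proof.
have l1 := lam_ge1; have l0 := lam_gt0.
have h1 : (u0 < s0.+1 * 16)%N by rewrite ltn_ceil.
have h2 : u0%:R + 1 <= (s0%:R + 1) * 16%:R :> R.
  by rewrite (natr1 u0) (natr1 s0) -natrM ler_nat.
have := small_size_bounds => /andP[h3 _].
(* This absorbs both roundings: z / 16 - 1 >= z / 20 exactly when z >= 80. *)
have xl : 80 <= x / lam.
  rewrite ler_pdivlMr//; apply: le_trans (_ : _ <= l) _; last first.
    by have := ln_small; have := l_gt0; lra.
  apply: le_trans lam_small; rewrite expr2; nra.
rewrite invfM mulrCA; lra.
Qed.

Lemma win0_N : m0%:R / N%:R <= l / x.
Proof.
have x0 := natr_gt0; have xl := natr_large; have /andP[_ h] := win0_bounds.
rewrite Nedges_natr ler_pdivrMr; last by rewrite divr_gt0// mulr_gt0//; lra.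
have -> : l / x * (x * (x - 1) / 2) = l * (x - 1) / 2 by field; lra.
apply: le_trans h _; have l0 := l_gt0.
have x40 : 40 <= x by lra.
by nra.
Qed.

Lemma win0_N_ge : 9 / 10 * (l / x) <= m0%:R / N%:R.
Proof.
have x0 := natr_gt0; have xl := natr_large; have /andP[h _] := win0_bounds.
rewrite Nedges_natr ler_pdivlMr; last by rewrite divr_gt0// mulr_gt0//; lra.
have -> : 9 / 10 * (l / x) * (x * (x - 1) / 2) = 9 / 20 * l * (x - 1) by field; lra.
apply: le_trans h; have := l_large; nra.
Qed.

Lemma win1_N : m1%:R / N%:R <= 3 * l / x.
Proof.
have x0 := natr_gt0; have xl := natr_large; have /andP[_ h] := win1_bounds.
rewrite Nedges_natr ler_pdivrMr; last by rewrite divr_gt0// mulr_gt0//; lra.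
have -> : 3 * l / x * (x * (x - 1) / 2) = 3 / 2 * l * (x - 1) by field; lra.
apply: le_trans h _; have := l_large; nra.
Qed.

(** The cost exp (9 K) is at most exp (0.144 l + 18), while the gain in the exponent is at least 3
    (7/8) (0.47 l) > 1.23 l; for large [l] more than 1.07 l remains. *)
Lemma poor_bound_le : poor_bound R n m0 K <= expR (- (107 / 100 * l)).
Proof.
have x0 := natr_gt0; have xl := natr_large; have ll := l_large; have /andP[h _] := win0_bounds.
have /andP[_ ht] := density_bounds.
rewrite /poor_bound -expRM_natl -expRD ler_expR.
have m3 : (3 <= m0)%N by rewrite -(ler_nat R); apply: le_trans h; nra.
have n4 : (4 <= n)%N by rewrite -(ler_nat R); lra.
rewrite natrM natrD natrM natrM natrB// natrB// Nedges_natr.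
set q := (m0%:R - 3) / _ / 2.
have e3 : expR (- 3) <= 1 / 8 :> R.
  have e1 : 2 <= expR 1 :> R by have := expR_ge1Dx (1 : R); lra.
  rewrite expRN (_ : expR 3 = expR 1 ^+ 3); last by rewrite -expRM_natl mulr1.
  rewrite div1r lef_pV2 ?posrE ?exprn_gt0 ?expR_gt0//.
  apply: le_trans (_ : _ <= 2 ^+ 3) _; first by lra.
  by apply: lerXn2r; rewrite ?nnegrE ?expR_ge0.
have qx : 47 / 100 * l <= q * (x - 4).
  have -> : q * (x - 4) = (m0%:R - 3) * (x - 4) / (x * (x - 1)).
    by rewrite /q; field; apply/andP; split; rewrite gt_eqF//; lra.
  rewrite ler_pdivlMr; last by rewrite mulr_gt0//; lra.
  apply: le_trans (_ : _ <= (19 / 40 * x * l - 1 - 3) * (x - 4)) _; last first.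
    by rewrite ler_wpM2r//; lra.
  have : 1000 * 1000 <= x * l by nra.
  nra.
have e0 : 0 < expR (- 3) :> R by rewrite expR_gt0.
have -> : q * (1 - expR (- 3)) * (3 * (x - 4)) = 3 * (1 - expR (- 3)) * (q * (x - 4)) by ring.
have : 3 * (1 - expR (- 3)) * (q * (x - 4)) >= 3 * (1 - 1 / 8) * (47 / 100 * l).
  apply: ler_pM; [lra|lra|lra|exact: qx].
have -> : 4%:R = 4 :> R by [].
lra.
Qed.

Local Notation pb := (poor_bound R n m0 K).
Local Notation p := (m1%:R / N%:R : R).
Local Notation C4 := ((400 / 7) ^+ 4 : R).

Lemma cube_decay (i : nat) : (i <= 3)%N -> x * l ^+ i * expR (- (107 / 100 * l)) <= C4 / l.
Proof.
move=> i3; have l0 := l_gt0; have l1 : 1 <= l by have := l_large; lra.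
have -> : x * l ^+ i * expR (- (107 / 100 * l)) = l ^+ i * expR (- (7 / 100 * l)).
  rewrite mulrAC natr_mul_expR mulrC; congr (_ * expR _); lra.
apply: le_trans (_ : _ <= l ^+ 3 * expR (- (7 / 100 * l))) _.
  by rewrite ler_wpM2r ?expR_ge0// ler_weXn2l.
rewrite expRN ler_pdivrMr ?expR_gt0// mulrAC ler_pdivlMr//.
have h : 0 <= 7 / 100 * l by lra.
(* The remaining decay exp (-0.07 l) is bounded by [pow4_expR], and [C4] cancels (7/400)^4. *)
apply: le_trans (_ : _ <= C4 * (7 / 100 * l / 4) ^+ 4) _; last first.
  by rewrite ler_wpM2l ?exprn_ge0 ?pow4_expR//; lra.
rewrite le_eqVlt; apply/orP; left; apply/eqP; field.
by [].
Qed.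

Lemma p_ge0 : 0 <= p. Proof. by rewrite divr_ge0. Qed.

(** The [i] edges cancel all but one of the [i.+1] powers of n, which [cube_decay] handles. The
    constant 216 is 8 * 3 ^ 3, from the star with three leaves. *)
Lemma structure_bound (c i : nat) : (c * 3 ^ i <= 216)%N -> (i <= 3)%N ->
  (c * n ^ i.+1)%:R * (p ^+ i * pb) <= 216 * C4 / l.
Proof.
move=> ci i3; have x0 := natr_gt0; have l0 := l_gt0.
have pi : p ^+ i <= (3 * l / x) ^+ i.
  by apply: lerXn2r win1_N; rewrite nnegrE ?p_ge0 ?divr_ge0 ?mulr_ge0 ?(ltW l0) ?(ltW x0).
apply: le_trans (_ : _ <= (c * n ^ i.+1)%:R * ((3 * l / x) ^+ i * expR (- (107 / 100 * l)))) _.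
  rewrite ler_wpM2l//; apply: ler_pM poor_bound_le => //; first by rewrite exprn_ge0// p_ge0.
  exact: poor_bound_ge0.
have -> : (c * n ^ i.+1)%:R * ((3 * l / x) ^+ i * expR (- (107 / 100 * l))) =
    (c * 3 ^ i)%:R * (x * l ^+ i * expR (- (107 / 100 * l))).
  rewrite !natrM !natrX expr_div_n exprMn exprS; field.
  by rewrite expf_neq0// gt_eqF.
have h := cube_decay i3; rewrite -[leRHS]mulrA.
apply: ler_pM => //; last by rewrite ler_nat.
by rewrite !mulr_ge0 ?exprn_ge0 ?expR_ge0 ?(ltW l0).
Qed.

Lemma dense_bound (u : nat) : (0 < u <= u0)%N ->
  ('C(n, u))%:R * (lam ^- (t * u) * expR (lam * (m0%:R / N%:R) * ('C(u, 2))%:R)) <=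
  expR (- (2 * l)).
Proof.
move=> /andP[u_gt0 uu0]; have x0 := natr_gt0; have l0 := l_gt0.
have lam0 := lam_gt0.
have u1 : 1 <= u%:R :> R by rewrite ler1n.
have ulam : u%:R * lam <= x.
  rewrite -ler_pdivlMr//; apply: le_trans (_ : _ <= u0%:R) _; first by rewrite ler_nat.
  by have /andP[] := small_size_bounds.
have /andP[tl _] := density_bounds.
have h1 : 'C(n, u)%:R <= expR (u%:R * l) :> R.
  rewrite expRM_natl -natr_expR_ln -natrX ler_nat; exact: leq_bin_exp.
(* As ln [lam] = 5000 and [t] >= l / 1250, this factor beats the two factors exp (u l) from the
   choice of the set ([h1]) and from the mean ([h3]), the latter using u [lam] <= n. *)
have h2 : lam ^- (t * u) <= expR (- (4 * (u%:R * l))).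
  rewrite lamE -expRM_natl -expRN ler_expR lerN2 natrM.
  have -> : t%:R * u%:R * (5 * 1000) = 5 * 1000 * t%:R * u%:R :> R by ring.
  by rewrite [u%:R * l]mulrC mulrA ler_wpM2r//; lra.
have h3 : expR (lam * (m0%:R / N%:R) * ('C(u, 2))%:R) <= expR (u%:R * l).
  rewrite ler_expR.
  apply: le_trans (_ : _ <= lam * (l / x) * (u * u)%:R) _.
    apply: ler_pM; rewrite ?mulr_ge0 ?(ltW lam0) ?invr_ge0//.
      by rewrite ler_wpM2l ?(ltW lam0)// win0_N.
    by rewrite ler_nat; apply: leq_trans (leq_bin_exp _ _) _; rewrite expnS expn1.
  rewrite natrM; have -> : lam * (l / x) * (u%:R * u%:R) = u%:R * l * (u%:R * lam / x).
    by field; rewrite gt_eqF.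
  rewrite ler_piMr ?mulr_ge0 ?(ltW l0)//.
  by rewrite ler_pdivrMr// mul1r.
apply: le_trans (_ : _ <= expR (u%:R * l) * (expR (- (4 * (u%:R * l))) * expR (u%:R * l))) _.
  apply: ler_pM => //; first by rewrite mulr_ge0 ?invr_ge0 ?exprn_ge0 ?expR_ge0 ?(ltW lam0).
  by apply: ler_pM => //; rewrite ?invr_ge0 ?exprn_ge0 ?expR_ge0 ?(ltW lam0).
rewrite -!exp.expRD ler_expR.
have ul : l <= u%:R * l by rewrite ler_peMl// ltW.
by clear h1 h2 h3 tl ulam u1; lra.
Qed.

Lemma dense_total : u0.+1%:R * expR (- (2 * l)) <= 2 / l.
Proof.
have x0 := natr_gt0; have l0 := l_gt0; have xl := natr_large.
have h : u0.+1%:R <= 2 * x.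
  rewrite -(natr1 u0); have /andP[_ h] := small_size_bounds.
  have : x / lam <= x by rewrite ler_pdivrMr ?lam_gt0// ler_peMr ?(ltW x0)// lam_ge1.
  lra.
apply: le_trans (_ : _ <= 2 * x * expR (- (2 * l))) _; first by rewrite ler_wpM2r ?expR_ge0.
have -> : 2 * x * expR (- (2 * l)) = 2 * expR (- l).
  by rewrite -mulrA natr_mul_expR; congr (_ * expR _); lra.
by rewrite ler_wpM2l// -[leRHS]div1r expR_le_inv.
Qed.

Lemma joined_bound :
  (2 ^ n * 2 ^ n * 2)%:R * expR (- (m0%:R / N%:R / 2 * (s0 ^ 2)%:R)) <= 1 / l.
Proof.
have x0 := natr_gt0; have l0 := l_gt0; have xl := natr_large.
have lam0 := lam_gt0.
have e1 : 2 <= expR 1 :> R by have := expR_ge1Dx (1 : R); lra.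
have h2 : (2 ^ n)%:R <= expR x.
  rewrite natrX -[x]mulr1 expRM_natl; apply: lerXn2r => //; rewrite nnegrE ?expR_ge0//.
have h3 : (2 ^ n * 2 ^ n * 2)%:R <= expR (3 * x).
  rewrite (_ : 3 * x = x + x + x) ?exp.expRD ?natrM; last by ring.
  apply: ler_pM; rewrite ?mulr_ge0//; first by apply: ler_pM.
  by apply: le_trans e1 _; rewrite ler_expR; lra.
(* By [lam_small] the exponent is at least 4.5 n, against at most exp (3 n) choices of the two sets
   and the colour. *)
have h4 : 4 * x <= m0%:R / N%:R / 2 * (s0 ^ 2)%:R.
  apply: le_trans (_ : _ <= 9 / 10 * (l / x) / 2 * (x / (20 * lam)) ^+ 2) _.
    have -> : 9 / 10 * (l / x) / 2 * (x / (20 * lam)) ^+ 2 = x * (9 / 8000 * l / lam ^+ 2).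
      by field; rewrite !gt_eqF.
    rewrite mulrC ler_wpM2l ?(ltW x0)// ler_pdivlMr ?exprn_gt0//.
    by move: lam_small; lra.
  have a0 : 0 <= x / (20 * lam) by rewrite divr_ge0 ?mulr_ge0 ?(ltW lam0)//; lra.
  have a1 : 0 <= l / x by rewrite divr_ge0 ?(ltW l0)//.
  apply: ler_pM.
  - lra.
  - exact: exprn_ge0.
  - have := win0_N_ge; lra.
  - by rewrite natrX; apply: lerXn2r linear_size_ge; rewrite nnegrE.
apply: le_trans (_ : _ <= expR (3 * x) * expR (- (4 * x))) _.
  by apply: ler_pM; rewrite ?expR_ge0// ler_expR lerN2.
rewrite -exp.expRD (_ : 3 * x - 4 * x = - x); last by ring.
apply: le_trans (expR_le_inv x0) _.
by rewrite !div1r lef_pV2 ?posrE//; have := ln_small; lra.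
Qed.

Lemma not_covered_bound : n%:R * ((N - m1)%:R / N%:R) ^+ n.-1 <= 1 / l.
Proof.
have x0 := natr_gt0; have l0 := l_gt0; have xl := natr_large.
have N0 : 0 < N%:R :> R by rewrite Nedges_natr divr_gt0// mulr_gt0//; lra.
have /andP[h _] := win1_bounds.
have h1 : (N - m1)%:R / N%:R <= expR (- p).
  have [mN|mN] := leqP m1 N; last first.
    by rewrite (_ : N - m1 = 0)%N ?mul0r ?expR_ge0//; apply/eqP; rewrite subn_eq0 ltnW.
  by rewrite natrB// mulrBl divff ?gt_eqF//; have := expR_ge1Dx (- p); lra.
apply: le_trans (_ : _ <= x * expR (- p) ^+ n.-1) _.
  by rewrite ler_wpM2l// lerXn2r// nnegrE ?expR_ge0// divr_ge0.
rewrite -expRM_natl natr_mul_expR.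
apply: le_trans (_ : _ <= expR (- l)) _; last exact: expR_le_inv.
rewrite ler_expR mulrN -subn1 natrB//.
(* Twice the threshold: the expected number of isolated vertices is at most n exp (-2 l) = exp
   (-l). *)
suff : 2 * l <= (x - 1) * p by lra.
rewrite Nedges_natr mulrA ler_pdivlMr; last by rewrite divr_gt0// mulr_gt0//; lra.
have -> : 2 * l * (x * (x - 1) / 2) = (x - 1) * (x * l) by field.
by rewrite ler_wpM2l//; lra.
Qed.

Lemma covered_bound :
  1 / (n%:R * late_prob R n m0 n.-1) + m0%:R / (N - m0 - n.-1 + 1)%:R <= 51 / l.
Proof.
have x0 := natr_gt0; have l0 := l_gt0; have xl := natr_large; have ll := l_large.
have lx := ln_small; have l2x := ln_sqr_le.
have /andP[_ h] := win0_bounds.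
have n1E : n.-1%:R = x - 1 by rewrite -subn1 natrB.
have hN : (m0 + n.-1 <= N)%N.
  by rewrite -(ler_nat R) natrD Nedges_natr n1E; nra.
have N1 : (n.-1 < N)%N by rewrite -(ltr_nat R) Nedges_natr n1E; nra.
pose y : R := m0%:R / (N - n.-1)%:R.
have N1E : (N - n.-1)%:R = (x - 1) * (x - 2) / 2 :> R.
  by rewrite natrB 1?ltnW// Nedges_natr n1E; field.
have N10 : 0 < (N - n.-1)%:R :> R by rewrite ltr0n subn_gt0.
have y0 : 0 <= y by rewrite divr_ge0.
have yn : (x - 1) * y <= 96 / 100 * l.
  rewrite /y mulrA ler_pdivrMr// N1E; nra.
have y1 : y <= 1 / 50.
  have : (x - 1) * y <= (x - 1) * (1 / 50) by apply: le_trans yn _; nra.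
  by rewrite ler_pM2l//; lra.
have g1 : (1 - y) ^+ n.-1 <= late_prob R n m0 n.-1.
  apply: le_trans (late_prob_ge R (b := n.-1) hN (leqnn _) N1).
  rewrite le_eqVlt; apply/orP; left; apply/eqP; congr (_ ^+ _).
  have -> : (N - m0 - n.-1 = N - n.-1 - m0)%N by rewrite subnAC.
  rewrite natrB; last by rewrite leq_subRL 1?addnC// ltnW.
  by rewrite mulrBl divff ?gt_eqF.
(* Below the threshold the exponent stays under [l], so the mean number of isolated vertices is at
   least exp (0.02 l), hence at least l / 50. *)
have g2 : expR (- (98 / 100 * l)) <= (1 - y) ^+ n.-1.
  have y2 : 0 < 1 - y by clear xl lx l2x h yn; lra.
  have e := expR_frac_le y2.
  apply: le_trans (_ : _ <= expR (- (y / (1 - y))) ^+ n.-1) _; last first.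
    by apply: lerXn2r; rewrite ?nnegrE ?expR_ge0// ltW.
  rewrite -expRM_natl ler_expR n1E mulrN lerN2 mulrA.
  rewrite (ler_pdivrMr _ _ y2).
  apply: le_trans yn _; apply: le_trans (_ : _ <= 98 / 100 * l * (1 - 1 / 50)) _.
    by lra.
  by rewrite ler_wpM2l//; lra.
have g3 : 1 / (n%:R * late_prob R n m0 n.-1) <= 50 / l.
  have : expR (2 / 100 * l) <= n%:R * late_prob R n m0 n.-1.
    apply: le_trans (_ : _ <= x * expR (- (98 / 100 * l))) _.
      by rewrite natr_mul_expR ler_expR; lra.
    by rewrite ler_wpM2l// (le_trans g2).
  move=> g4; have g5 : 2 / 100 * l <= n%:R * late_prob R n m0 n.-1.
    by apply: le_trans g4; have := expR_ge1Dx (2 / 100 * l); lra.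
  have l50 : 0 < 2 / 100 * l by lra.
  apply: le_trans (_ : _ <= 1 / (2 / 100 * l)) _.
    by rewrite !div1r lef_pV2 ?posrE// (lt_le_trans l50).
  by rewrite le_eqVlt; apply/orP; left; apply/eqP; field; lra.
have r1 : m0%:R / (N - m0 - n.-1 + 1)%:R <= 1 / l.
  have dE : (N - m0 - n.-1 + 1)%:R = x * (x - 1) / 2 - m0%:R - (x - 1) + 1 :> R.
    rewrite natrD -subnDA natrB// natrD Nedges_natr n1E; ring.
  rewrite dE ler_pdivrMr; last by nra.
  rewrite mulrC mulrA ler_pdivlMr// mulr1.
  apply: le_trans (_ : _ <= 19 / 40 * x * l * l) _; first by rewrite ler_wpM2r// ltW.
  have xl1 : 1000 * (x * l) <= x * x by rewrite mulrCA ler_wpM2l// ltW.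
  have xl2 : 1000 * (x * (l * l)) <= x * x.
    by rewrite mulrCA ler_wpM2l ?(ltW x0)// -expr2; nra.
  nra.
rewrite (_ : 51 / l = 50 / l + 1 / l); last by field; lra.
exact: lerD.
Qed.

End Asymptotics.

(** * An explicit bound of order 1 / ln n on the failure probability *)

Section FailureBound.
Variables (R : realType) (n : nat) (lam : R).
Local Notation N := (Nedges n).
Local Notation x := (n%:R : R).
Local Notation l := (ln (n%:R : R)).
Hypothesis lamE : lam = expR (5 * 1000).
Hypotheses (n0 : (0 < n)%N) (l_large : 100 * 1000 <= l) (lam_small : 4000 * lam ^+ 2 <= l).

(** Three structure bounds, and 55 = 2 + 1 + 1 + 51 from dense sets, unjoined sets and the two ends
    of the window for [tau1]. *)
Definition fail_const : R := 3 * (216 * (400 / 7) ^+ 4) + 55.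

Lemma Pr_fail_le :
  Pr R (fun w : {perm edge n} * {ffun edge n -> bool} => ~~ asbool (all_pairs_zebraic w.1 w.2)) <=
  fail_const / l.
Proof.
pose m0 := win0 R n; pose m1 := win1 R n; pose t := density R n.
pose u0 := small_size n lam; pose s0 := linear_size n lam.
have x0 : 0 < x by rewrite ltr0n.
have l0 : 0 < l by apply: lt_le_trans l_large; lra.
have xl := natr_large n0 l_large; have lx := ln_small n0 l_large.
have /andP[m0l m0r] := win0_bounds l_large; have /andP[m1l m1r] := win1_bounds l_large.
have lam0 : 0 < lam by rewrite lamE expR_gt0.
have NE := Nedges_natr R n0.
have xxl : 1000 * (x * l) <= x * x by rewrite mulrCA ler_wpM2l// ltW.
have xx : 1000 * 1000 * x <= x * x by rewrite ler_wpM2r// ltW.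
have lx1 : 100 * 1000 * x <= x * l by rewrite [leLHS]mulrC ler_wpM2l// ltW.
have n1E : n.-1%:R = x - 1 by rewrite -subn1 natrB.
have m1N : (m1 <= N)%N by rewrite -(ler_nat R) NE; apply: le_trans m1r _; lra.
have m01 : (m0 <= m1)%N.
  by rewrite -(ler_nat R); apply: le_trans m0r _; apply: le_trans m1l; lra.
have m03 : (3 < m0)%N by rewrite -(ltr_nat R); apply: lt_le_trans m0l; lra.
have n1 : (1 < n)%N by rewrite -(ltr_nat R); lra.
have m0n : (m0 + n.-1 < N)%N by rewrite -(ltr_nat R) natrD NE n1E; lra.
have t0 : (0 < t)%N.
  have /andP[h _] := density_bounds l_large.
  by rewrite -(ltr_nat R); apply: lt_le_trans h; rewrite divr_gt0//; lra.
have s00 : (0 < s0)%N.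
  rewrite -(ltr_nat R); apply: lt_le_trans (linear_size_ge lamE n0 l_large lam_small).
  by rewrite divr_gt0// mulr_gt0//; lra.
have su0 : (16 * s0 <= u0)%N by rewrite mulnC leq_trunc_div.
have b0 : 0 <= expR (- (2 * l)) by rewrite expR_ge0.
have lam1 : 1 <= lam := lam_ge1 lamE.
have := Pr_atypical m1N m01 m03 n1 m0n t0 s00 su0 lam1 b0
  (dense_bound lamE n0 l_large).
set K := (16 * t + 2)%N => H.
apply: le_trans (_ : _ <= Pr R (fun w => ~~ typical m0 m1 t u0 s0 w)) _.
  apply: Pr_sub => w; apply: contraNN => /(typical_zebraic m1N t0 s00 su0).
  by rewrite /asbool; case: ClassicalEpsilon.excluded_middle_informative.
have B1 := @structure_bound R n n0 l_large 8 3 isT isT.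
have B2 := @structure_bound R n n0 l_large 2 1 isT isT.
have B3 := @structure_bound R n n0 l_large 2 2 isT isT.
have B4 := dense_total lamE n0 l_large.
have B5 := joined_bound lamE n0 l_large lam_small.
have B6 := not_covered_bound n0 l_large.
have B7 := covered_bound n0 l_large.
rewrite expr1 in B2.
apply: le_trans H _.
apply: le_trans (lerD (lerD (lerD (lerD (lerD (lerD B1 B2) B3) B4) B5) B6) B7) _.
rewrite /fail_const le_eqVlt; apply/orP; left; apply/eqP.
by field; rewrite gt_eqF.
Qed.

End FailureBound.

(** * Passage to the limit *)

Theorem theorem4 :
  forall eps : rat, 0 < eps ->
  exists N : nat, forall n : nat, (N <= n)%N -> (prob_fail n <= eps)%R.
Proof.
move=> eps eps0; pose R := Rdefinitions.R : realType.
pose lam : R := expR (5 * 1000); pose C := fail_const R.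
have e0 : 0 < ratr eps :> R by rewrite ltr0q.
(* Once ln n >= [M], both largeness hypotheses hold and C / ln n is at most [eps]. *)
pose M : R := Num.max (Num.max (100 * 1000) (4000 * lam ^+ 2)) (C / ratr eps).
exists (Num.truncn (expR M)).+1 => n Mn.
have xM : expR M <= n%:R.
  by apply: ltW; apply: lt_le_trans (truncnS_gt _) _; rewrite ler_nat.
have n0 : (0 < n)%N by apply: leq_trans Mn.
have lM : M <= ln (n%:R : R) by rewrite -ler_expR lnK// posrE ltr0n.
have : [&& 100 * 1000 <= ln (n%:R : R), 4000 * lam ^+ 2 <= ln (n%:R : R) &
           C / ratr eps <= ln (n%:R : R)].
  by move: lM; rewrite !ge_max -andbA.
move=> /and3P[l1 l2 l3].
have l0 : 0 < ln (n%:R : R) by apply: lt_le_trans l1; lra.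
have := Pr_fail_le (erefl lam) n0 l1 l2; rewrite -/C => H.
rewrite -(ler_rat R) /prob_fail fmorph_div /= !ratr_nat -Pr_card.
apply: le_trans H _; rewrite ler_pdivrMr// mulrC.
by rewrite -ler_pdivrMr.
Qed.
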